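(* Let $\Theta\subset\mathbb{R}^p$ be a nonempty connected open set, $X\subset\mathbb{R}^n$ nonempty closed convex, $Y\subset\mathbb{R}^m$ nonempty convex compact, and $\alpha>0$. For each $\theta\in\Theta$ let $\Phi_\theta:\mathbb{R}^n\times\mathbb{R}^m\to\mathbb{R}$ be continuous such that $\Phi_\theta(\cdot,y)$ is $\alpha$-strongly convex for every $y$ and $-\Phi_\theta(x,\cdot)$ is $\alpha$-strongly convex for every $x$, and assume $\theta\mapsto\Phi_\theta(x,y)$ is Lipschitz on $\Theta$ for all $(x,y)$. Define the operator $\mathcal{A}_\theta$ on $\mathbb{R}^{n}\times\mathbb{R}^m$ by $\mathcal{A}_\theta(x,y)=\big(\partial_x\Phi_\theta(x,y)+N_X(x)\big)\times\big(\partial_y(-\Phi_\theta)(x,y)+N_Y(y)\big)$. Let $\gamma\in(0,1/\alpha)$ and assume that $T(\theta,z):=\mathcal{R}_{\gamma\mathcal{A}_\theta}(z)$ is path differentiable jointly in $(\theta,z)\in\Theta\times\mathbb{R}^{n+m}$. Then for each $\theta$ the min-max problem $\min_{x\in X}\max_{y\in Y}\Phi_\theta(x,y)$ has a unique saddle point $z^\star(\theta)=(x^\star(\theta),y^\star(\theta))$ (the unique zero of $\mathcal{A}_\theta$), and $\theta\mapsto z^\star(\theta)$ is path differentiable on $\Theta$ with conservative Jacobian $$\mathcal{J}_{z^\star}(\theta)=\big\{(\mathrm{Id}_{n+m}-V)^{-1}U:\ [U\ V]\in\mathrm{Jac}^c_T(\theta,z^\star(\theta))\big\},$$ with $U\in\mathbb{R}^{(n+m)\times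 p}$, $V\in\mathbb{R}^{(n+m)\times(n+m)}$.
   Context: $\partial_x\Phi_\theta(x,y)$ is the convex subdifferential of $\Phi_\theta(\cdot,y)$ at $x$, $\partial_y(-\Phi_\theta)(x,y)$ that of $-\Phi_\theta(x,\cdot)$ at $y$; $N_X,N_Y$ are normal cones. The resolvent of a maximal monotone $\mathcal{A}$ is $\mathcal{R}_{\mathcal{A}}=(\mathrm{Id}+\mathcal{A})^{-1}$. Clarke Jacobian: for a locally Lipschitz $F:\mathbb{R}^N\to\mathbb{R}^k$, $\mathrm{Jac}^c_F(z)=\mathrm{conv}\{\lim_j \mathrm{Jac}_F(z_j): z_j\to z,\ F \text{ differentiable at } z_j\}$. A conservative Jacobian for a locally Lipschitz $F$ is a set-valued map $\mathcal{J}_F$ with nonempty values, locally bounded, with closed graph, such that for every absolutely continuous curve $c:[0,1]\to\mathbb{R}^N$, for almost every $t$, $\frac{d}{dt}F(c(t))=M\dot c(t)$ for all $M\in\mathcal{J}_F(c(t))$. $F$ is path differentiable if it is locally Lipschitz and admits a conservative Jacobian. Jacobians of maps of $(\theta,z)$ are written $[U\ V]$ with $U$ the $\theta$-block and $V$ the $z$-block of the joint Jacobian. *)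

(* Defs.v *)
From HB Require Import structures.
From mathcomp Require Import all_boot all_order all_algebra.
From mathcomp Require Import all_classical all_reals all_analysis.
Set Implicit Arguments. Unset Strict Implicit. Unset Printing Implicit Defensive.
Import Order.TTheory GRing.Theory Num.Theory.
Import numFieldNormedType.Exports.
Local Open Scope classical_set_scope.
Local Open Scope ring_scope.

Section Defs.
Context {R : realType}.

Definition dotc N (u v : 'cV[R]_N) : R := \sum_(i < N) u i 0 * v i 0.
Definition sqn N (u : 'cV[R]_N) : R := dotc u u.

Definition strongly_convex N (a : R) (f : 'cV[R]_N -> R) : Prop :=
  forall x y t, 0 <= t <= 1 ->
    f (t *: x + (1 - t) *: y) <=
      t * f x + (1 - t) * f y - a / 2 * t * (1 - t) * sqn (x - y).

Definition subdiff N (f : 'cV[R]_N -> R) (x : 'cV[R]_N) : set 'cV[R]_N :=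
  [set g | forall x', f x + dotc g (x' - x) <= f x'].

Definition normal_cone N (X : set 'cV[R]_N) (x : 'cV[R]_N) : set 'cV[R]_N :=
  [set v | X x /\ forall x', X x' -> dotc v (x' - x) <= 0].

Definition msum N (A B : set 'cV[R]_N) : set 'cV[R]_N :=
  [set w | exists a b, A a /\ B b /\ w = a + b].

(* The operator A_theta(x,y) = (d_x Phi(x,y) + N_X(x)) x (d_y(-Phi)(x,y) + N_Y(y)),
   with z = (x,y) stored as col_mx x y. *)
Definition saddle_op n m (Phi : 'cV[R]_n -> 'cV[R]_m -> R)
    (X : set 'cV[R]_n) (Y : set 'cV[R]_m) (z : 'cV[R]_(n + m)) : set 'cV[R]_(n + m) :=
  [set w | msum (subdiff (fun x' => Phi x' (dsubmx z)) (usubmx z))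
                (normal_cone X (usubmx z)) (usubmx w) /\
           msum (subdiff (fun y' => - Phi (usubmx z) y') (dsubmx z))
                (normal_cone Y (dsubmx z)) (dsubmx w)].

Definition is_resolvent N (A : 'cV[R]_N -> set 'cV[R]_N) (gamma : R)
    (z w : 'cV[R]_N) : Prop :=
  exists a, A w a /\ z - w = gamma *: a.

Definition is_saddle n m (Phi : 'cV[R]_n -> 'cV[R]_m -> R)
    (X : set 'cV[R]_n) (Y : set 'cV[R]_m) (z : 'cV[R]_(n + m)) : Prop :=
  X (usubmx z) /\ Y (dsubmx z) /\
  forall x y, X x -> Y y ->
    Phi (usubmx z) y <= Phi (usubmx z) (dsubmx z) /\
    Phi (usubmx z) (dsubmx z) <= Phi x (dsubmx z).

Definition locally_lipschitz N k (D : set 'cV[R]_N) (F : 'cV[R]_N -> 'cV[R]_k) : Prop :=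
  forall z, D z -> exists r : R, 0 < r /\ exists L : R,
    forall u v, `|u - z| < r -> `|v - z| < r -> `|F u - F v| <= L * `|u - v|.

Definition abs_cont_curve N (c : R -> 'cV[R]_N) : Prop :=
  forall e : R, 0 < e -> exists d : R, 0 < d /\
    forall (k : nat) (a b : 'I_k -> R),
      (forall i, 0 <= a i /\ a i <= b i /\ b i <= 1) ->
      (forall i j, i != j -> b i <= a j \/ b j <= a i) ->
      \sum_(i < k) (b i - a i) < d ->
      \sum_(i < k) `|c (b i) - c (a i)| < e.

Definition conservative_jacobian N k (D : set 'cV[R]_N) (F : 'cV[R]_N -> 'cV[R]_k)
    (J : 'cV[R]_N -> set 'M[R]_(k, N)) : Prop :=
  (forall z, D z -> J z !=set0) /\
  (forall z, D z -> exists r : R, 0 < r /\ exists B : R,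
      forall z' M, D z' -> `|z' - z| < r -> J z' M -> `|M| <= B) /\
  (forall (zs : nat -> 'cV[R]_N) (Ms : nat -> 'M[R]_(k, N)) z M,
      (forall j, D (zs j) /\ J (zs j) (Ms j)) ->
      zs @ \oo --> z -> Ms @ \oo --> M -> D z -> J z M) /\
  (forall c : R -> 'cV[R]_N, abs_cont_curve c -> (forall t, 0 <= t <= 1 -> D (c t)) ->
      {ae (@lebesgue_measure R), forall t : R, 0 <= t <= 1 ->
         derivable c t 1 /\ derivable (F \o c) t 1 /\
         forall M, J (c t) M -> 'D_1 (F \o c) t = M *m 'D_1 c t}).

Definition path_differentiable N k (D : set 'cV[R]_N) (F : 'cV[R]_N -> 'cV[R]_k) : Prop :=
  locally_lipschitz D F /\ exists J, conservative_jacobian D F J.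

(* Jacobian matrix of F at z (meaningful where F is differentiable) *)
Definition jac N k (F : 'cV[R]_N -> 'cV[R]_k) (z : 'cV[R]_N) : 'M[R]_(k, N) :=
  \matrix_(i < k, j < N) ('d F z (delta_mx j 0)) i 0.

Definition clarke_lim N k (F : 'cV[R]_N -> 'cV[R]_k) (z : 'cV[R]_N) : set 'M[R]_(k, N) :=
  [set M | exists s : nat -> 'cV[R]_N,
     (forall j, differentiable F (s j)) /\ s @ \oo --> z /\
     (fun j => jac F (s j)) @ \oo --> M].

Definition clarke_jac N k (F : 'cV[R]_N -> 'cV[R]_k) (z : 'cV[R]_N) : set 'M[R]_(k, N) :=
  [set M | exists (q : nat) (w : 'I_q -> R) (Ms : 'I_q -> 'M[R]_(k, N)),
     (forall i, 0 <= w i) /\ \sum_(i < q) w i = 1 /\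
     (forall i, clarke_lim F z (Ms i)) /\ M = \sum_(i < q) w i *: Ms i].

End Defs.

(* Main.v *)
(* At a point where [T] is differentiable, the contraction property of the
   resolvent in [z] (strong monotonicity of the saddle operator) gives
   |V x|^2 <= q |x|^2 with q = (1 + gamma alpha)^-2 < 1, and this bound passes to
   limits and convex combinations.  Hence [1 - V] is invertible on the whole
   Clarke Jacobian with a uniform bound, and the fixed point z*(theta) of
   T(theta, .) is locally Lipschitz.  Differentiating
   T(theta, z*(theta)) = z*(theta) along a curve gives (1 - V) dz* = U dtheta,
   provided that the Clarke Jacobian of [T] is itself conservative.

   For the last point no Rademacher or Fubini argument is used.  A Lipschitz
   function on [0, 1] whose derivative is a.e. at most c increases by at most c
   (cover the exceptional null set by a small open set); with the upper
   semicontinuity of a conservative Jacobian J this yields: if M v = d for all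
   M in J(z), then M v = d for all M in the Clarke Jacobian at z.  That the
   latter is nonempty follows from Baire's theorem: the set where two elements
   of J(z) differ by at least 1/n on a basis vector is closed and contains no
   segment in that direction, so J is single-valued on a dense set, and there
   [T] is differentiable. *)
Require Import Defs.
From HB Require Import structures.
From mathcomp Require Import all_boot all_order all_algebra.
From mathcomp Require Import all_classical all_reals all_analysis measurable_realfun.
From mathcomp Require Import ring lra.
Import Order.TTheory GRing.Theory Num.Theory.
Import numFieldNormedType.Exports.
Local Open Scope classical_set_scope.
Local Open Scope ring_scope.
Set Implicit Arguments.
Unset Strict Implicit.

(** * Increments of Lipschitz functions *)

(** Continuous induction: the supremum of the [t] up to which the bound holds satisfies it too, and
    a step from there would pass it unless it is 1. The monotone [m] is an error budget; continuity
    is asked of [phi] only. *)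
Lemma increment_le_of_steps (R : realType) (phi m : R -> R) (L c C : R) :
  0 <= C ->
  (forall s t, 0 <= s <= 1 -> 0 <= t <= 1 -> `|phi s - phi t| <= L * `|s - t|) ->
  (forall s t, 0 <= s -> s <= t -> t <= 1 -> m s <= m t) ->
  (forall s, 0 <= s < 1 -> exists s', s < s' <= 1 /\
     phi s' - phi s <= c * (s' - s) + C * (m s' - m s)) ->
  phi 1 - phi 0 <= c + C * (m 1 - m 0).
Proof.
move=> C0 phiL mnd step.
pose P t := phi t - phi 0 <= c * t + C * (m t - m 0).
pose S := [set t | 0 <= t <= 1 /\ P t].
have S0 : S 0 by rewrite /S /P /= !subrr !mulr0 addr0 lexx ler01.
have Sub : ubound S 1 by move=> t [/andP[]].
have supS : has_sup S by split; [exists 0 | exists 1].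
have s0 : 0 <= sup S by apply: ub_le_sup => //; exists 1.
have s1 : sup S <= 1 by apply: ge_sup => //; exists 0.
have s01 : 0 <= sup S <= 1 by rewrite s0 s1.
have Psup : P (sup S).
  apply/ler_addgt0Pr => e e0.
  pose K := L + `|c| + 1.
  have L0 : 0 <= L.
    have := phiL 0 1 _ _; rewrite !lexx ler01 => /(_ isT isT).
    by rewrite sub0r normrN normr1 mulr1; apply: le_trans.
  have K0 : 0 < K by rewrite /K; have := normr_ge0 c; lra.
  have [t [/andP[t0 t1] Pt] tS] := sup_adherent (divr_gt0 e0 K0) supS.
  have ts : t <= sup S by apply: ub_le_sup => //; [exists 1 | split=> //; rewrite t0].
  have := phiL (sup S) t s01 _; rewrite t0 t1 => /(_ isT).
  rewrite (ger0_norm (_ : 0 <= sup S - t)) ?subr_ge0//.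
  move=> /(le_trans (ler_norm _)) h1.
  have h2 : C * (m t - m 0) <= C * (m (sup S) - m 0).
    by apply: ler_wpM2l => //; rewrite lerD2r; apply: mnd.
  have h3 : c * t <= c * sup S + `|c| * (sup S - t).
    have : - c * (sup S - t) <= `|c| * (sup S - t).
      by apply: ler_wpM2r; rewrite ?subr_ge0// -normrN ler_norm.
    lra.
  have h4 : K * (sup S - t) <= e.
    rewrite -[leRHS](divfK (lt0r_neq0 K0)) mulrC; apply: ler_wpM2r; lra.
  have : (L + `|c|) * (sup S - t) <= K * (sup S - t).
    by apply: ler_wpM2r; rewrite ?subr_ge0// /K; lra.
  move: Pt; rewrite /P; lra.
suff e1 : 1 = sup S by move: Psup; rewrite /P -e1 mulr1.
apply/eqP; rewrite eq_le s1 andbT leNgt; apply/negP => sl1.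
have [|s' [/andP[ss' s'1] h]] := step (sup S); first by rewrite s0.
have Ss' : S s'.
  split; first by rewrite s'1 andbT; lra.
  by move: Psup h; rewrite /P; lra.
by have := ub_le_sup (ex_intro _ 1 Sub) Ss'; rewrite leNgt ss'.
Qed.

(** Steps starting outside a small open cover [U] of the exceptional set use the derivative; steps
    starting inside use the Lipschitz constant and are charged to the measure of [U]. *)
Lemma ae_derivative_increment_le (R : realType) (phi : R -> R) (L c : R) :
  (forall s t, 0 <= s <= 1 -> 0 <= t <= 1 -> `|phi s - phi t| <= L * `|s - t|) ->
  {ae (@lebesgue_measure R), forall t : R, 0 <= t <= 1 ->
     derivable phi t 1 /\ 'D_1 phi t <= c} ->
  phi 1 - phi 0 <= c.
Proof.
move=> phiL [A [mA A0 badA]].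
have L0 : 0 <= L.
  have := phiL 0 1 _ _; rewrite !lexx ler01 => /(_ isT isT).
  by rewrite sub0r normrN normr1 mulr1; apply: le_trans.
have K0 : 0 < L + `|c| + 2 by have := normr_ge0 c; lra.
apply/ler_addgt0Pr => e e0.
(* The final error is [eta] times 1 + L + |c|, which is below [e]. *)
pose eta := e / (L + `|c| + 2).
have eta0 : 0 < eta by rewrite divr_gt0.
have etaE : e = eta * (L + `|c| + 2) by rewrite /eta divfK// lt0r_neq0.
have Afin : (lebesgue_measure A < +oo :> \bar R)%E.
  by rewrite (A0 : lebesgue_measure A = 0%E).
have [U [oU AU muUA]] := lebesgue_regularity_outer mA Afin eta0.
have mU : measurable U by exact: open_measurable.
have muU : (lebesgue_measure U <= eta%:E)%E.
  have -> : U = (U `\` A) `|` A.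
    by rewrite setUC setDUK.
  apply: le_trans (measureU2 _ _ _) _ => //; first exact: measurableD.
  by rewrite [X in (_ + X)%E](A0 : _ = 0%E) adde0 ltW.
pose I (t : R) : set R := U `&` `[0, t]%classic.
pose m (t : R) : R := fine (lebesgue_measure (I t)).
have mUt (t : R) : measurable (I t) by exact: measurableI.
have muUt (t : R) : (lebesgue_measure (I t) <= eta%:E)%E.
  by apply: le_trans muU; apply: le_measure; [apply/mem_set; exact: mUt|apply/mem_set; exact: mU|exact: subIsetl].
have finUt (t : R) : (lebesgue_measure (I t)) \is a fin_num.
  rewrite ge0_fin_numE//; apply: le_lt_trans (muUt t) _; exact: ltry.
have m_le (t : R) : m t <= eta by rewrite -lee_fin fineK.
have m_ge (t : R) : 0 <= m t by rewrite fine_ge0.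
have mnd (s t : R) : 0 <= s -> s <= t -> t <= 1 -> m s <= m t.
  move=> _ st _; rewrite -lee_fin !fineK//; apply: le_measure; [apply/mem_set; exact: mUt|apply/mem_set; exact: mUt|].
  apply: setIS => x /=; rewrite !in_itv/= => /andP[-> /=] xs.
  exact: le_trans st.
have mstep (s t : R) : 0 <= s -> s <= t -> t <= 1 -> `]s, t]%classic `<=` U ->
    t - s <= m t - m s.
  move=> s0 st t1 stU.
  rewrite -(lerD2r (m s)) subrK -lee_fin EFinD !fineK//.
  have -> : (t - s)%:E = lebesgue_measure (`]s, t]%classic : set R).
    by rewrite lebesgue_measure_itv/= lte_fin; case: ltgtP st => // ->; rewrite subrr.
  have -> : (lebesgue_measure (`]s, t]%classic : set R) + lebesgue_measure (I s))%E =
      lebesgue_measure (`]s, t]%classic `|` I s).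
    rewrite measureU//; first exact: mUt.
    rewrite -subset0 => x [/= + [_ /=]]; rewrite !in_itv/= => /andP[sx _] /andP[_ xs].
    by move: sx; rewrite ltNge xs.
  apply: le_measure; [apply/mem_set/measurableU; [exact: measurable_itv|exact: mUt]|apply/mem_set; exact: mUt|].
  move=> x [xst|[Ux]].
    split; first exact: stU.
    move: xst; rewrite /= !in_itv/= => /andP[sx ->]; rewrite andbT; lra.
  rewrite /= !in_itv/= => /andP[x0 xs]; split => //=; rewrite in_itv/= x0/=; lra.
suff : phi 1 - phi 0 <= (c + eta) + (L + `|c|) * (m 1 - m 0).
  move/le_trans; apply.
  have : (L + `|c|) * (m 1 - m 0) <= (L + `|c|) * eta.
    apply: ler_wpM2l; first by have := normr_ge0 c; lra.
    by have := m_le 1; have := m_ge 0; lra.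
  lra.
apply: (increment_le_of_steps _ phiL mnd) => [|s /andP[s0 s1]]; first by have := normr_ge0 c; lra.
have s01 : 0 <= s <= 1 by rewrite s0 ltW.
have [Us|nUs] := pselect (U s).
  (* An interval to the right of [s] lies in [U], so [m] grows there by at least the length of the
     step and pays for the Lipschitz bound. *)
  have /nbhs_ballP[r /= r0 rU] : nbhs s U by exact: open_nbhs_nbhs.
  pose s' := Num.min (s + r / 2) 1.
  have ss' : s < s' by rewrite lt_min s1 andbT; lra.
  have s'1 : s' <= 1 by rewrite ge_min lexx orbT.
  have s'r : s' <= s + r / 2 by rewrite ge_min lexx.
  exists s'; rewrite ss' s'1; split=> //.
  have h1 := mstep s s' s0 (ltW ss') s'1 _.
  have : s' - s <= m s' - m s.
    apply: h1 => x /=; rewrite in_itv/= => /andP[sx xs]; apply: rU.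
    rewrite /ball/= ltr_distlC; apply/andP; split; lra.
  move=> {}h1.
  have := phiL s' s _ s01; rewrite s'1 (le_trans s0 (ltW ss')) => /(_ isT).
  rewrite (ger0_norm (_ : 0 <= s' - s)) ?subr_ge0 ?(ltW ss')//.
  move=> /(le_trans (ler_norm _)) h2.
  have h3 : (L + `|c|) * (s' - s) <= (L + `|c|) * (m s' - m s).
    by apply: ler_wpM2l => //; have := normr_ge0 c; lra.
  have : - c * (s' - s) <= `|c| * (s' - s).
    by apply: ler_wpM2r; rewrite ?subr_ge0 ?(ltW ss')// -normrN ler_norm.
  have : 0 <= eta * (s' - s) by apply: mulr_ge0; lra.
  lra.
have nAs : ~ A s by move=> /AU.
have [ds Ds] : derivable phi s 1 /\ 'D_1 phi s <= c.
  by apply: contrapT => bad; apply: nAs; apply: badA => /= /(_ s01).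
have := ds; rewrite /derivable => /cvg_ex[l] hl.
have lc : l <= c.
  suff <- : 'D_1 phi s = l by [].
  by apply: cvg_lim.
have : \forall h \near 0^'+, (h^-1 *: (phi (h *: 1 + s) - phi s)) <= c + eta.
  have : \forall h \near 0^', (h^-1 *: (phi (h *: 1 + s) - phi s)) < c + eta.
    apply: (cvgr_lt l) => //; lra.
  rewrite !near_withinE; apply: filterS => h hc h0.
  by apply/ltW/hc; rewrite gt_eqF.
move=> near_q.
near (0 : R)^'+ => h.
have h0 : 0 < h by near: h; exact: nbhs_right_gt.
have h1 : h <= 1 - s by near: h; apply: nbhs_right_le; rewrite subr_gt0.
have hq : h^-1 *: (phi (h *: 1 + s) - phi s) <= c + eta by near: h.
exists (s + h); split; first by apply/andP; split; lra.
move: hq; rewrite [h *: 1]mulr1 [_ *: _]mulrC ler_pdivrMr// (addrC h s).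
have : 0 <= (L + `|c|) * (m (s + h) - m s).
  apply: mulr_ge0; first by have := normr_ge0 c; lra.
  by rewrite subr_ge0; apply: mnd => //; lra.
lra.
Unshelve. all: by end_near. Qed.

Lemma ae_lebesgue_impl (R : realType) (P Q : R -> Prop) :
  (forall t, P t -> Q t) ->
  {ae (@lebesgue_measure R), forall t, P t} ->
  {ae (@lebesgue_measure R), forall t, Q t}.
Proof.
move=> PQ [A [mA A0 sA]]; exists A; split=> // t /= nQ.
by apply: sA => /= Pt; apply: nQ; apply: PQ.
Qed.

(** The endpoints form a null set. The chain rule below compares derivatives at interior points
    only, since its identity between curves is known on [[0, 1]] alone. *)
Lemma ae_lebesgue_segment (R : realType) (a b : R) (P : R -> Prop) :
  {ae (@lebesgue_measure R), forall t, a < t < b -> P t} ->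
  {ae (@lebesgue_measure R), forall t, a <= t <= b -> P t}.
Proof.
move=> [A [mA A0 sA]]; exists (A `|` ([set a] `|` [set b])); split.
- by do ?apply: measurableU.
- have E1 (x : R) : lebesgue_measure [set x] = 0%E by exact: lebesgue_measure_set1.
  apply/eqP; rewrite -measure_le0.
  apply: le_trans (measureU2 _ mA _) _; first by do ?apply: measurableU.
  rewrite [X in (X + _)%E](A0 : _ = 0%E) add0e.
  apply: le_trans (measureU2 _ _ _) _ => //.
  by rewrite [X in (X + _)%E](E1 a) [X in (_ + X)%E](E1 b) adde0.
move=> t /= nP; have [->|ta] := eqVneq t a; first by right; left.
have [->|tb] := eqVneq t b; first by right; right.
left; apply: sA => /= Pt; apply: nP => /andP[at' tb']; apply: Pt.
by rewrite !lt_neqAle at' tb' eq_sym ta tb.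
Qed.

Lemma ae_lebesgue_exists (R : realType) (P : R -> Prop) :
  {ae (@lebesgue_measure R), forall t, 0 <= t <= 1 -> P t} ->
  exists t, 0 <= t <= 1 /\ P t.
Proof.
move=> [A [mA A0 sA]]; apply: contrapT => nP.
have : (lebesgue_measure (`[0%R, 1%R]%classic : set R) <= lebesgue_measure A)%E.
  apply: le_measure; [apply/mem_set; exact: measurable_itv|exact/mem_set|].
  move=> t /=; rewrite in_itv/= => t01; apply: sA => /= /(_ t01) Pt.
  by apply: nP; exists t.
rewrite [X in (_ <= X)%E](A0 : _ = 0%E) lebesgue_measure_itv/= lte01.
by rewrite sube0 leNgt lte01.
Qed.

(** * Matrix norms and set-valued maps *)

(** Makes matrices with the max-norm a complete normed space, as the theorems of Baire and Banach
    require. *)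
HB.instance Definition _ (R : realType) m n := Complete.on 'M[R]_(m, n).

Lemma mx_norm_entry (R : realType) m n (M : 'M[R]_(m, n)) i j : `|M i j| <= `|M|.
Proof.
by rewrite [leRHS]/Num.norm /= mx_normrE; apply: (le_bigmax _ _ (i, j)).
Qed.

Lemma mx_norm_le (R : realType) m n (M : 'M[R]_(m, n)) (e : R) :
  0 <= e -> (forall i j, `|M i j| <= e) -> `|M| <= e.
Proof.
move=> e0 Me; rewrite [leLHS]/Num.norm /= mx_normrE; by apply/bigmax_leP; split.
Qed.

Lemma mx_norm_mulmx_le (R : realType) m n p (A : 'M[R]_(m, n)) (B : 'M[R]_(n, p)) :
  `|A *m B| <= n%:R * `|A| * `|B|.
Proof.
apply: mx_norm_le => [|i j]; first by rewrite !mulr_ge0.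
rewrite mxE (le_trans (ler_norm_sum _ _ _))//.
apply: (@le_trans _ _ (\sum_(l < n) `|A| * `|B|)).
  by apply: ler_sum => l _; rewrite normrM ler_pM// mx_norm_entry.
by rewrite sumr_const card_ord -mulrA mulr_natl lexx.
Qed.

Lemma cvg_seqP (R : realType) (V : normedModType R) (u : nat -> V) (l : V) :
  u @ \oo --> l <->
  forall e : R, 0 < e -> exists K, forall k, (K <= k)%N -> `|u k - l| < e.
Proof.
split=> [/cvgrPdist_lt ul e e0|ul].
  have [K _ hK] := ul e e0; exists K => k Kk; rewrite distrC; exact: hK.
apply/cvgrPdist_lt => e /ul[K hK]; exists K => // k /hK.
by rewrite distrC.
Qed.

Lemma mx_cvg_seqP (R : realType) m n (u : nat -> 'M[R]_(m, n)) (M : 'M[R]_(m, n)) :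
  u @ \oo --> M <-> forall i j, (fun k => u k i j) @ \oo --> M i j.
Proof.
split=> [uM i j|uM].
  exact: (@cvg_comp _ _ _ u (fun A : 'M[R]_(m, n) => A i j) _ _ _ uM (@coord_continuous R m n i j M)).
move=> A [P MP PA]; have : \forall k \near \oo, forall i j, P i j (u k i j).
  apply: (filter_forall (F := \oo)) => i; apply: filter_forall => j.
  exact: uM (MP i j).
by apply: filterS => k hk; apply: PA.
Qed.

Lemma increasing_seq_ge (f : nat -> nat) : increasing_seq f -> forall k, (k <= f k)%N.
Proof.
move=> /increasing_seqP fS; elim=> // k IH; apply: leq_ltn_trans IH _.
by have := fS k.
Qed.

Lemma cvg_subseq (T : topologicalType) (u : nat -> T) (f : nat -> nat) (l : T) :
  increasing_seq f -> u @ \oo --> l -> (u \o f) @ \oo --> l.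
Proof.
move=> fi ul; apply: cvg_comp ul => A [K _ KA].
by exists K => // k /= Kk; apply: KA => /=; apply: leq_trans Kk (increasing_seq_ge fi k).
Qed.

Lemma finite_bolzano_weierstrass (R : realType) (I : finType) (u : I -> nat -> R) (B : R) :
  (forall i k, `|u i k| <= B) ->
  exists f l, increasing_seq f /\ forall i, (u i \o f) @ \oo --> (l i : R).
Proof.
move=> uB.
suff [f [fi cf]] : exists f, increasing_seq f /\ forall i, i \in enum I -> cvgn (u i \o f).
  exists f, (fun i => limn (u i \o f)); split=> // i; apply: cf.
  by rewrite mem_enum.
elim: (enum I) => [|i s [f [fi fs]]]; first by exists id.
have [|g gi cg] := @bolzano_weierstrass R (u i \o f).
  exists B; split; first exact: num_real.
  by move=> x Bx k _; apply: le_trans (uB _ _) (ltW Bx).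
exists (f \o g); split; first by move=> a b; exact: etrans (fi _ _) (gi _ _).
move=> j; rewrite inE => /orP[/eqP -> //|/fs /cvg_ex[l jl]].
by apply/cvg_ex; exists l; exact: cvg_subseq gi jl.
Qed.

Lemma mx_bolzano_weierstrass (R : realType) m n (u : nat -> 'M[R]_(m, n)) (B : R) :
  (forall k, `|u k| <= B) ->
  exists f (M : 'M[R]_(m, n)), increasing_seq f /\ (u \o f) @ \oo --> M.
Proof.
move=> uB.
have [f [l [fi ul]]] := @finite_bolzano_weierstrass R ('I_m * 'I_n)%type
  (fun ij k => u k ij.1 ij.2) B (fun ij k => le_trans (mx_norm_entry _ _ _) (uB k)).
exists f, (\matrix_(i, j) l (i, j)); split=> //.
by apply/mx_cvg_seqP => i j; rewrite mxE; exact: ul (i, j).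
Qed.

(** This and [closed_graph_map] are two clauses of [conservative_jacobian], with the number of
    columns freed from [N] so that they also apply to pairs of matrices placed side by side. *)
Definition locally_bounded_map (R : realType) N k l (D : set 'cV[R]_N)
    (J : 'cV[R]_N -> set 'M[R]_(k, l)) : Prop :=
  forall z, D z -> exists r : R, 0 < r /\ exists B : R,
    forall z' M, D z' -> `|z' - z| < r -> J z' M -> `|M| <= B.

Definition closed_graph_map (R : realType) N k l (D : set 'cV[R]_N)
    (J : 'cV[R]_N -> set 'M[R]_(k, l)) : Prop :=
  forall (zs : nat -> 'cV[R]_N) (Ms : nat -> 'M[R]_(k, l)) z M,
    (forall j, D (zs j) /\ J (zs j) (Ms j)) ->
    zs @ \oo --> z -> Ms @ \oo --> M -> D z -> J z M.

Lemma cvg_seq_harmonic (R : realType) (V : normedModType R) (u : nat -> V) (l : V) (r : R) :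
  0 < r -> (forall j, `|u j - l| < r / j.+1%:R) -> u @ \oo --> l.
Proof.
move=> r0 ul; apply/cvg_seqP => e e0.
exists (Num.truncn (r / e)) => k ek; apply: lt_le_trans (ul k) _.
rewrite ler_pdivrMr// mulrC -ler_pdivrMr//.
by apply/ltW/(lt_le_trans (truncnS_gt _)); rewrite ler_nat.
Qed.

(** Otherwise elements outside [P] at points tending to [z] would accumulate, by compactness, at an
    element of [J z], which lies in the open set [P]. *)
Lemma upper_semicontinuous_map (R : realType) N k l (D : set 'cV[R]_N)
    (J : 'cV[R]_N -> set 'M[R]_(k, l)) (z : 'cV[R]_N) (P : set 'M[R]_(k, l)) :
  locally_bounded_map D J -> closed_graph_map D J -> D z -> open P -> J z `<=` P ->
  exists d : R, 0 < d /\ forall z' M, D z' -> `|z' - z| < d -> J z' M -> P M.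
Proof.
move=> Jb Jc Dz oP JP; have [r [r0 [B hB]]] := Jb z Dz.
apply: contrapT => H.
have {H} H j : exists zM : 'cV[R]_N * 'M[R]_(k, l),
    [/\ D zM.1, `|zM.1 - z| < r / j.+1%:R, J zM.1 zM.2 & ~ P zM.2].
  apply: contrapT => H'; apply: H; exists (r / j.+1%:R).
  split; first by rewrite divr_gt0.
  move=> z' M Dz' z'z JM; apply: contrapT => nP; apply: H'.
  by exists (z', M).
have [s hs] := choice H.
have sz : (fst \o s) @ \oo --> z.
  by apply: (cvg_seq_harmonic r0) => j; have [] := hs j.
have [|f [M [fi fM]]] := @mx_bolzano_weierstrass R k l (snd \o s) B.
  move=> j; have [Dj szj Jj _] := hs j; apply: hB Jj => //.
  apply: lt_le_trans szj _; rewrite ler_pdivrMr//.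
  by rewrite ler_peMr ?ler1n// ltW.
have /JP PM : J z M.
  apply: (Jc (fst \o (s \o f)) (snd \o (s \o f))) => //.
    by move=> j; have [] := hs (f j).
  exact: cvg_subseq sz.
have [K _ /(_ K (leqnn K))] : \forall j \near \oo, P ((snd \o s \o f) j).
  by apply: fM; exact: open_nbhs_nbhs.
by have [] := hs (f K).
Qed.

(** * Mean values under a conservative Jacobian *)

Lemma abs_cont_segment (R : realType) N (z h : 'cV[R]_N) :
  abs_cont_curve (fun t : R => z + t *: h).
Proof.
move=> e e0; have K0 : 0 < `|h| + 1 by rewrite ltr_wpDl.
exists (e / (`|h| + 1)); split=> [|k a b ab _ sab]; first by rewrite divr_gt0.
apply: (@le_lt_trans _ _ ((\sum_(i < k) (b i - a i)) * (`|h| + 1))); last first.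
  by rewrite -ltr_pdivlMr.
rewrite mulr_suml; apply: ler_sum => i _.
have [ai [abi bi]] := ab i.
rewrite opprD addrACA subrr add0r -scalerBl normrZ ger0_norm ?subr_ge0//.
by rewrite ler_wpM2l ?subr_ge0// lerDl.
Qed.

(** A bound at small distances is enough: in a family of disjoint intervals of total length below
    [d0], each interval is shorter than [d0]. *)
Lemma abs_cont_dominated (R : realType) N M (c : R -> 'cV[R]_N) (w : R -> 'cV[R]_M)
    (K d0 : R) :
  abs_cont_curve c -> 0 < d0 ->
  (forall s t, 0 <= s -> s <= t -> t <= 1 -> t - s < d0 ->
     `|w t - w s| <= K * `|c t - c s|) ->
  abs_cont_curve w.
Proof.
move=> cac d00 wc e e0; have K0 : 0 < `|K| + 1 by rewrite ltr_wpDl.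
have [d [d_gt0 hd]] := cac _ (divr_gt0 e0 K0).
exists (Num.min d d0); split=> [|k a b ab disj]; first by rewrite lt_min d_gt0.
rewrite lt_min => /andP[sd sd0].
apply: (@le_lt_trans _ _ ((\sum_(i < k) `|c (b i) - c (a i)|) * (`|K| + 1))); last first.
  by rewrite -ltr_pdivlMr//; apply: hd.
rewrite mulr_suml; apply: ler_sum => i _.
have [ai [abi bi]] := ab i.
apply: le_trans (wc _ _ ai abi bi _) _.
  apply: le_lt_trans sd0; rewrite (bigD1 i)//= lerDl; apply: sumr_ge0 => j _.
  by have [_ [abj _]] := ab j; rewrite subr_ge0.
rewrite mulrC ler_wpM2l//; apply: le_trans (ler_norm _) _; lra.
Qed.

Lemma is_derive_segment (R : realType) N (z h : 'cV[R]_N) (t : R) :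
  is_derive t 1 (fun s : R => z + s *: h) h.
Proof.
have : (fun e : R => e^-1 *: (((fun s : R => z + s *: h) \o shift t) (e *: 1) -
   (z + t *: h))) @ 0^' --> h.
  apply: (@cvg_trans _ ((fun _ : R => h) @ 0^')); last exact: cvg_cst.
  apply: near_eq_cvg; near=> e => /=.
  have e0 : e != 0 by near: e; exact: nbhs_dnbhs_neq.
  rewrite [e *: 1]mulr1 opprD addrACA subrr add0r -scalerBl addrK scalerA.
  by rewrite mulVf// scale1r.
move=> H; split; first by apply/cvg_ex; exists h.
exact: cvg_lim.
Unshelve. all: by end_near. Qed.

(** Along the segment the derivative of [F] is almost everywhere [M *m h] for any [M] in [J], hence
    within [e] of [d]. The increment lemma, applied to each coordinate with both signs, integrates
    this bound. *)
Lemma conservative_mean_value (R : realType) N k (D : set 'cV[R]_N)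
    (F : 'cV[R]_N -> 'cV[R]_k) (J : 'cV[R]_N -> set 'M[R]_(k, N))
    (z h : 'cV[R]_N) (d : 'cV[R]_k) (L e : R) :
  conservative_jacobian D F J ->
  (forall t, 0 <= t <= 1 -> D (z + t *: h)) ->
  (forall s t, 0 <= s <= 1 -> 0 <= t <= 1 ->
     `|F (z + s *: h) - F (z + t *: h)| <= L * `|s - t|) ->
  (forall t M, 0 <= t <= 1 -> J (z + t *: h) M -> `|M *m h - d| <= e) ->
  `|F (z + h) - F z - d| <= e.
Proof.
move=> [Jne [_ [_ Jc]]] Dseg FL Je.
have e0 : 0 <= e.
  have t0 : 0 <= (0 : R) <= 1 by rewrite lexx ler01.
  have [M JM] := Jne _ (Dseg 0 t0).
  exact: le_trans (Je _ _ t0 JM).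
suff H (s : R) i : `|s| = 1 -> s * (F (z + h) - F z - d) i 0 <= e.
  apply: mx_norm_le => // i j; rewrite (ord1 j) ler_norml.
  have := H 1 i; rewrite normr1 mul1r => /(_ erefl) ->; rewrite andbT.
  have := H (-1) i; rewrite normrN normr1 mulN1r => /(_ erefl).
  by rewrite lerNl.
move=> s1.
pose phi t := s * F (z + t *: h) i 0.
have : phi 1 - phi 0 <= s * d i 0 + e.
  apply: (@ae_derivative_increment_le R phi L) => [a b a01 b01|].
    rewrite /phi -mulrBr normrM s1 mul1r.
    apply: le_trans (FL _ _ a01 b01).
    have := mx_norm_entry (F (z + a *: h) - F (z + b *: h)) i 0.
    by rewrite !mxE.
  have := Jc _ (abs_cont_segment z h) Dseg.
  apply: ae_lebesgue_impl => t /[swap] t01 /(_ t01)[dc [dF MJ]].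
  have [M JM] := Jne _ (Dseg t t01).
  have dG := (derivable_mxP _ _ _).1 dF i 0.
  have -> : phi = s \*: (fun x => (F \o (fun x => z + x *: h)) x i 0).
    by apply/funext => x.
  split; first exact: derivableZ.
  rewrite deriveZ//=.
  have -> : 'D_1 (fun x : R => F (z + x *: h) i 0) t = (M *m h) i 0.
    have := MJ M JM; rewrite derive_mx//.
    have [_ ->] := is_derive_segment z h t.
    by move=> /matrixP/(_ i 0); rewrite mxE.
  rewrite -lerBlDl -[s *: _]/(s * _) -mulrBr.
  apply: le_trans (ler_norm _) _; rewrite normrM s1 mul1r.
  apply: le_trans (Je t M t01 JM).
  by have := mx_norm_entry (M *m h - d) i 0; rewrite !mxE.
rewrite /phi scale1r scale0r addr0 !mxE; lra.
Qed.

Lemma mulmx_cvg (R : realType) k N l (u : nat -> 'M[R]_(k, N)) (M : 'M[R]_(k, N))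
    (v : 'M[R]_(N, l)) :
  u @ \oo --> M -> (fun j => u j *m v) @ \oo --> M *m v.
Proof.
move=> /cvg_seqP uM; apply/cvg_seqP => e e0.
have K0 : 0 < N%:R * `|v| + 1 by rewrite ltr_wpDl// mulr_ge0.
have [K hK] := uM _ (divr_gt0 e0 K0); exists K => j /hK.
rewrite ltr_pdivlMr// -mulmxBl; apply: le_lt_trans.
apply: le_trans (mx_norm_mulmx_le _ _) _.
have := normr_ge0 (u j - M); lra.
Qed.

Lemma open_mulmx_close (R : realType) k N l (v : 'M[R]_(N, l)) (d : 'M[R]_(k, l)) (e : R) :
  open [set M : 'M[R]_(k, N) | `|M *m v - d| < e].
Proof.
rewrite openE => M /= Me; apply/nbhs_ballP.
have K0 : 0 < N%:R * `|v| + 1 by rewrite ltr_wpDl// mulr_ge0.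
exists ((e - `|M *m v - d|) / (N%:R * `|v| + 1)) => /=.
  by rewrite divr_gt0// subr_gt0.
move=> M'; rewrite mx_norm_ball /ball_/= distrC ltr_pdivlMr// => M'M.
have -> : M' *m v - d = (M' - M) *m v + (M *m v - d).
  by rewrite mulmxBl addrA subrK.
apply: le_lt_trans (ler_normD _ _) _; rewrite -ltrBrDr.
apply: le_lt_trans M'M; apply: le_trans (mx_norm_mulmx_le _ _) _.
have := normr_ge0 (M' - M); lra.
Qed.

Lemma cvg_norm_sub_le (R : realType) (V : normedModType R) (u : nat -> V) (l d : V) (e : R) :
  u @ \oo --> l -> (exists K, forall j, (K <= j)%N -> `|u j - d| <= e) -> `|l - d| <= e.
Proof.
move=> /cvg_seqP ul [K hK]; apply/ler_addgt0Pr => r r0.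
have [K' hK'] := ul r r0.
rewrite -(subrKA (u (maxn K K'))) addrC; apply: le_trans (ler_normD _ _) _.
rewrite lerD// ?hK ?leq_maxl// distrC ltW// hK'// leq_maxr.
by [].
Qed.

Lemma jac_mulmx (R : realType) N k (F : 'cV[R]_N -> 'cV[R]_k) (z v : 'cV[R]_N) :
  jac F z *m v = 'd F z v.
Proof.
have -> : v = \sum_(j < N) v j 0 *: delta_mx j 0.
  by rewrite {1}[v]matrix_sum_delta; apply: eq_bigr => i _; rewrite big_ord1.
rewrite mulmx_sumr linear_sum; apply: eq_bigr => j _.
rewrite -scalemxAr linearZ; congr (_ *: _).
by apply/colP => i; rewrite -colE !mxE.
Qed.

Lemma jac_mulmx_cvg (R : realType) N k (F : 'cV[R]_N -> 'cV[R]_k) (z v : 'cV[R]_N) :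
  differentiable F z ->
  (fun j => j.+1%:R *: (F (z + j.+1%:R^-1 *: v) - F z)) @ \oo --> jac F z *m v.
Proof.
move=> dF; rewrite jac_mulmx -deriveE//.
have /= := diff_derivable (v := v) dF.
rewrite /derivable => cF.
have harm0 : (fun j : nat => j.+1%:R^-1 : R) @ \oo --> (0 : R)^'.
  move=> A /= [e /= e0 eA].
  have /cvg_seqP := @cvg_harmonic R => /(_ e e0)[K hK].
  exists K => // j /= /hK; rewrite subr0 => hj; apply: eA.
    by rewrite /ball/= sub0r normrN.
  by rewrite invr_eq0.
have := @cvg_comp _ _ _ _ _ _ _ _ harm0 (cF : _ --> _).
apply: cvg_trans; apply: near_eq_cvg; apply: nearW => j /=.
by rewrite invrK (addrC z).
Qed.

Lemma jac_mulmx_close (R : realType) N k (F : 'cV[R]_N -> 'cV[R]_k) (z v : 'cV[R]_N)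
    (d : 'cV[R]_k) (e r : R) :
  differentiable F z -> 0 < r ->
  (forall t, 0 < t < r -> `|F (z + t *: v) - F z - t *: d| <= t * e) ->
  `|jac F z *m v - d| <= e.
Proof.
move=> dF r0 H; apply: (cvg_norm_sub_le (jac_mulmx_cvg (v := v) dF)).
have /cvg_seqP := @cvg_harmonic R => /(_ r r0)[K hK].
exists K => j /hK; rewrite subr0 ger0_norm ?invr_ge0// => jr.
have j0 : 0 < j.+1%:R^-1 :> R by rewrite invr_gt0.
have := H (j.+1%:R^-1) _; rewrite j0 jr => /(_ isT).
rewrite -(ler_pM2l (_ : 0 < j.+1%:R))// mulrA mulfV// mul1r.
rewrite -{1}(ger0_norm (_ : 0 <= j.+1%:R)) ?ler0n// -normrZ scalerBr scalerA.
by rewrite mulfV// scale1r.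
Qed.

Lemma differentiable_of_linear_approx (R : realType) N k (F : 'cV[R]_N -> 'cV[R]_k)
    (z : 'cV[R]_N) (M : 'M[R]_(k, N)) :
  (forall e, 0 < e -> exists d : R, 0 < d /\
     forall h, `|h| < d -> `|F (z + h) - F z - M *m h| <= e * `|h|) ->
  differentiable F z.
Proof.
move=> H; pose df : {linear 'cV[R]_N -> 'cV[R]_k} := mulmx M.
have dfc : continuous df.
  move=> x A /= /nbhs_ballP[e /= e0 eA]; apply/nbhs_ballP.
  have K0 : 0 < N%:R * `|M| + 1 by rewrite ltr_wpDl// mulr_ge0.
  exists (e / (N%:R * `|M| + 1)); first by rewrite /= divr_gt0.
  move=> y; rewrite mx_norm_ball /ball_/= ltr_pdivlMr// => xy; apply: eA.
  rewrite mx_norm_ball /ball_/= -mulmxBr; apply: le_lt_trans xy.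
  apply: le_trans (mx_norm_mulmx_le _ _) _.
  have := normr_ge0 (x - y); lra.
have E : F \o shift z = cst (F z) + df +o_ 0 id.
  apply/eqaddoP => e e0; have [d [d0 hd]] := H e e0.
  apply/nbhs_ballP; exists d => //= h.
  rewrite mx_norm_ball /ball_/= sub0r normrN => /hd.
  by rewrite (addrC z) -addrA -opprD.
have dE := diff_unique dfc E.
by apply/diff_locallyP; rewrite dE.
Qed.

Lemma open_ballP (R : realType) N (D : set 'cV[R]_N) (z : 'cV[R]_N) :
  open D -> D z -> exists r : R, 0 < r /\ forall y, `|y - z| < r -> D y.
Proof.
move=> oD Dz; have /nbhs_ballP[r /= r0 rD] : nbhs z D by exact: open_nbhs_nbhs.
by exists r; split=> // y yz; apply: rD; rewrite mx_norm_ball /ball_/= distrC.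
Qed.

Lemma segment_ball (R : realType) N (z s h : 'cV[R]_N) (r t : R) :
  `|s - z| < r -> `|s + h - z| < r -> 0 <= t <= 1 -> `|s + t *: h - z| < r.
Proof.
move=> sz shz /andP[t0 t1].
have -> : s + t *: h - z = (1 - t) *: (s - z) + t *: (s + h - z).
  rewrite addrAC [s + h - z]addrAC; set a := s - z.
  by rewrite [t *: (a + h)]scalerDr addrA -scalerDl subrK scale1r.
apply: le_lt_trans (ler_normD _ _) _; rewrite !normrZ !ger0_norm ?subr_ge0//.
have [t_0|t_0] := eqVneq t 0; first by rewrite t_0 mul0r subr0 mul1r addr0.
have t_gt0 : 0 < t by rewrite lt_neqAle eq_sym t_0.
have -> : r = (1 - t) * r + t * r by rewrite -mulrDl subrK mul1r.
by rewrite ler_ltD ?ltr_pM2l// ler_wpM2l ?subr_ge0// ltW.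
Qed.

(** Upper semicontinuity puts every element of [J] near [z] in [P], so the mean value bound holds
    there. The radius is independent of [s], [h], [d] and [e]: one use fixes a direction, another
    treats all directions at once. *)
Lemma conservative_increment (R : realType) N k (D : set 'cV[R]_N)
    (F : 'cV[R]_N -> 'cV[R]_k) (J : 'cV[R]_N -> set 'M[R]_(k, N))
    (z : 'cV[R]_N) (P : set 'M[R]_(k, N)) :
  open D -> locally_lipschitz D F -> conservative_jacobian D F J ->
  D z -> open P -> J z `<=` P ->
  exists r : R, 0 < r /\ forall s h d e, `|s - z| < r -> `|s + h - z| < r ->
    (forall M, P M -> `|M *m h - d| <= e) -> `|F (s + h) - F s - d| <= e.
Proof.
move=> oD FL Jcons Dz oP JP; have [_ [Jb [Jc _]]] := Jcons.
have [r1 [r1_gt0 usc]] := upper_semicontinuous_map Jb Jc Dz oP JP.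
have [r2 [r2_gt0 rD]] := open_ballP oD Dz.
have [r3 [r3_gt0 [L hL]]] := FL z Dz.
exists (Num.min r1 (Num.min r2 r3)); split; first by rewrite !lt_min r1_gt0 r2_gt0.
move=> s h d e sz shz Pe.
have seg t : 0 <= t <= 1 ->
    [/\ `|s + t *: h - z| < r1, `|s + t *: h - z| < r2 & `|s + t *: h - z| < r3].
  move=> t01; have := segment_ball sz shz t01.
  by rewrite !lt_min => /and3P[].
apply: (@conservative_mean_value R N k D F J s h d (L * `|h|)) => //.
- by move=> t /seg[_ /rD].
- move=> a b a01 b01; have [_ _ ha] := seg a a01; have [_ _ hb] := seg b b01.
  apply: le_trans (hL _ _ ha hb) _.
  by rewrite opprD addrACA subrr add0r -scalerBl normrZ mulrCA mulrC.
- move=> t M t01 JM; apply: Pe; have [h1 h2 _] := seg t t01.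
  by apply: usc JM => //; exact: rD.
Qed.

(** * Clarke Jacobians of path differentiable maps *)

(** Near [z] all elements of [J] send [v] close to [d]. The mean value bound transfers this to
    difference quotients of [F], then to [jac F] at nearby points of differentiability, and then to
    the limit. *)
Lemma clarke_lim_mulmx (R : realType) N k (D : set 'cV[R]_N)
    (F : 'cV[R]_N -> 'cV[R]_k) (J : 'cV[R]_N -> set 'M[R]_(k, N))
    (z v : 'cV[R]_N) (d : 'cV[R]_k) M :
  open D -> locally_lipschitz D F -> conservative_jacobian D F J -> D z ->
  (forall M', J z M' -> M' *m v = d) -> clarke_lim F z M -> M *m v = d.
Proof.
move=> oD FL Jcons Dz Jd [s [sd [sz sM]]].
apply/eqP; rewrite -subr_eq0 -normr_le0; apply/ler_addgt0Pr => e e0.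
rewrite add0r.
have [|r [r0 hr]] := conservative_increment oD FL Jcons Dz (@open_mulmx_close R k N 1 v d e).
  by move=> M' /Jd /= ->; rewrite subrr normr0.
apply: (cvg_norm_sub_le (mulmx_cvg (v := v) sM)).
have r2 : 0 < r / 2 by rewrite divr_gt0.
have /cvg_seqP/(_ _ r2)[K hK] := sz; exists K => j /hK sjz.
have K0 : 0 < `|v| + 1 by rewrite ltr_wpDl.
(* Half of [r] is spent on the distance from [s j] to [z], the other half on the displacement
   [t *: v]. *)
apply: (@jac_mulmx_close _ _ _ _ _ _ _ _ (r / 2 / (`|v| + 1))) => //.
  exact: divr_gt0.
move=> t /andP[t0]; rewrite ltr_pdivlMr// => tv.
apply: hr; first lra.
  rewrite addrAC; apply: le_lt_trans (ler_normD _ _) _.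
  by rewrite normrZ gtr0_norm//; lra.
move=> M' /= M'e; rewrite -scalemxAr -scalerBr normrZ gtr0_norm//.
by rewrite ler_pM2l// ltW.
Qed.

(** Used with [v] the velocity of a curve: almost everywhere, all elements of a conservative
    Jacobian agree on it, and the Clarke Jacobian then gives the same value. This is its chain
    rule. *)
Lemma clarke_jac_mulmx (R : realType) N k (D : set 'cV[R]_N)
    (F : 'cV[R]_N -> 'cV[R]_k) (J : 'cV[R]_N -> set 'M[R]_(k, N))
    (z v : 'cV[R]_N) (d : 'cV[R]_k) M :
  open D -> locally_lipschitz D F -> conservative_jacobian D F J -> D z ->
  (forall M', J z M' -> M' *m v = d) -> clarke_jac F z M -> M *m v = d.
Proof.
move=> oD FL Jcons Dz Jd [q [w [Ms [w0 [w1 [hMs ->]]]]]].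
rewrite mulmx_suml -[RHS]scale1r -w1 scaler_suml; apply: eq_bigr => i _.
by rewrite -scalemxAl (clarke_lim_mulmx oD FL Jcons Dz Jd (hMs i)).
Qed.

Lemma jac_norm_le (R : realType) N k (F : 'cV[R]_N -> 'cV[R]_k) (z s : 'cV[R]_N) (r L : R) :
  (forall u v, `|u - z| < r -> `|v - z| < r -> `|F u - F v| <= L * `|u - v|) ->
  `|s - z| < r -> differentiable F s -> `|jac F s| <= `|L|.
Proof.
move=> FL sz sd; apply: mx_norm_le => // i j.
have -> : jac F s i j = (jac F s *m delta_mx j (0 : 'I_1) - 0) i 0.
  by rewrite subr0 -colE [RHS]mxE.
apply: le_trans (mx_norm_entry _ _ _) _.
have rs : 0 < r - `|s - z| by rewrite subr_gt0.
have nd : `|delta_mx j (0 : 'I_1) : 'cV[R]_N| <= 1.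
  apply: mx_norm_le => // a b; by rewrite mxE; case: (_ && _); rewrite ?normr1 ?normr0.
apply: jac_mulmx_close rs _ => // t /andP[t0 tr].
have tn : `|t *: (delta_mx j (0 : 'I_1) : 'cV[R]_N)| <= t.
  by rewrite normrZ gtr0_norm// ler_piMr// ltW.
rewrite scaler0 subr0; apply: le_trans (FL _ _ _ _) _ => //.
  rewrite addrAC; apply: le_lt_trans (ler_normD _ _) _; lra.
rewrite addrAC subrr add0r mulrC; apply: le_trans (ler_norm _) _.
by rewrite normrM normr_id ler_wpM2r.
Qed.

Lemma clarke_lim_norm_le (R : realType) N k (F : 'cV[R]_N -> 'cV[R]_k) (z z' : 'cV[R]_N)
    (r L : R) M :
  (forall u v, `|u - z| < r -> `|v - z| < r -> `|F u - F v| <= L * `|u - v|) ->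
  `|z' - z| < r -> clarke_lim F z' M -> `|M| <= `|L|.
Proof.
move=> FL z'z [s [sd [sz' sM]]]; rewrite -[M]subr0.
apply: (cvg_norm_sub_le sM).
have rz : 0 < r - `|z' - z| by rewrite subr_gt0.
have /cvg_seqP/(_ _ rz)[K hK] := sz'; exists K => j /hK sjz.
rewrite subr0; apply: jac_norm_le FL _ (sd j).
rewrite -(subrKA z'); apply: le_lt_trans (ler_normD _ _) _; lra.
Qed.

Lemma clarke_jac_norm_le (R : realType) N k (F : 'cV[R]_N -> 'cV[R]_k) (z z' : 'cV[R]_N)
    (r L : R) M :
  (forall u v, `|u - z| < r -> `|v - z| < r -> `|F u - F v| <= L * `|u - v|) ->
  `|z' - z| < r -> clarke_jac F z' M -> `|M| <= `|L|.
Proof.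
move=> FL z'z [q [w [Ms [w0 [w1 [hMs ->]]]]]].
apply: le_trans (ler_norm_sum _ _ _) _.
rewrite -[leRHS]mul1r -w1 mulr_suml; apply: ler_sum => i _.
by rewrite normrZ ger0_norm// ler_wpM2l//; exact: clarke_lim_norm_le FL z'z (hMs i).
Qed.

Lemma cvg_lsubmx (R : realType) k N1 N2 (u : nat -> 'M[R]_(k, N1 + N2))
    (M : 'M[R]_(k, N1 + N2)) :
  u @ \oo --> M -> (fun j => lsubmx (u j)) @ \oo --> lsubmx M.
Proof.
move=> /mx_cvg_seqP uM; apply/mx_cvg_seqP => i j; rewrite mxE.
by under eq_fun do rewrite mxE; exact: uM.
Qed.

Lemma cvg_rsubmx (R : realType) k N1 N2 (u : nat -> 'M[R]_(k, N1 + N2))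
    (M : 'M[R]_(k, N1 + N2)) :
  u @ \oo --> M -> (fun j => rsubmx (u j)) @ \oo --> rsubmx M.
Proof.
move=> /mx_cvg_seqP uM; apply/mx_cvg_seqP => i j; rewrite mxE.
by under eq_fun do rewrite mxE; exact: uM.
Qed.

Lemma mx_norm_row_mx_le (R : realType) k N1 N2 (A : 'M[R]_(k, N1 + N2)) (e : R) :
  `|lsubmx A| <= e -> `|rsubmx A| <= e -> `|A| <= e.
Proof.
move=> le re; apply: mx_norm_le => [|i j]; first exact: le_trans le.
case: (split_ordP j) => a ->.
- by apply: le_trans le; have := mx_norm_entry (lsubmx A) i a; rewrite mxE.
- by apply: le_trans re; have := mx_norm_entry (rsubmx A) i a; rewrite mxE.
Qed.

Lemma mulmx_col_mx_opp (R : realType) k N l (A : 'M[R]_(k, N + N)) (v : 'M[R]_(N, l)) :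
  A *m col_mx v (- v) = (lsubmx A - rsubmx A) *m v.
Proof. by rewrite -[A in LHS]hsubmxK mul_row_col mulmxN mulmxBl. Qed.

(** * Points where a conservative Jacobian is single-valued *)

Section SingletonDense.
Variables (R : realType) (N k : nat) (D : set 'cV[R]_N).
Variables (F : 'cV[R]_N -> 'cV[R]_k) (J : 'cV[R]_N -> set 'M[R]_(k, N)).
Hypotheses (oD : open D) (Jcons : conservative_jacobian D F J).

(* Two elements of [J z] side by side; [A *m col_mx v (- v)] is then the
   difference of their values on [v]. *)
Let pairs (z : 'cV[R]_N) : set 'M[R]_(k, N + N) :=
  [set A | J z (lsubmx A) /\ J z (rsubmx A)].

Let pairs_bounded : locally_bounded_map D pairs.
Proof.
move=> z Dz; have [_ [Jb _]] := Jcons; have [r [r0 [B hB]]] := Jb z Dz.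
exists r; split=> //; exists B => z' A Dz' zz' [Jl Jr].
by apply: mx_norm_row_mx_le; apply: hB zz' _.
Qed.

Let pairs_closed : closed_graph_map D pairs.
Proof.
move=> zs Ms z M H zsz MsM Dz; have [_ [_ [Jc _]]] := Jcons; split.
- by apply: Jc zsz (cvg_lsubmx MsM) Dz => j; have [? []] := H j.
- by apply: Jc zsz (cvg_rsubmx MsM) Dz => j; have [? []] := H j.
Qed.

Let wide (v : 'cV[R]_N) (e : R) : set 'cV[R]_N :=
  [set z | D z /\ exists A, pairs z A /\ e <= `|A *m col_mx v (- v)|].

(** Where all pairs satisfy the strict inequality, upper semicontinuity extends it to a
    neighbourhood, so the set is closed relative to [D]. *)
Let closure_wide v e z : D z -> closure (wide v e) z -> wide v e z.
Proof.
move=> Dz clz; split=> //; apply: contrapT => nw.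
have [|d [d0 hd]] := upper_semicontinuous_map pairs_bounded pairs_closed Dz
  (@open_mulmx_close R k _ 1 (col_mx v (- v)) 0 e).
  move=> A Az /=; rewrite subr0 ltNge; apply/negP => eA.
  by apply: nw; exists A.
have : nbhs z [set y | `|y - z| < d].
  by apply/nbhs_ballP; exists d => //= y; rewrite mx_norm_ball /ball_/= distrC.
move=> /clz[y [[Dy [A [Ay eA]]] /= yz]].
by have := hd y A Dy yz Ay; rewrite /= subr0 ltNge eA.
Qed.

(** A nonempty open subset of the closure would contain a segment of direction [v] inside
    [wide v e]. At almost every point of it the chain rule makes all elements of [J] agree on [v],
    which excludes a gap of size [e]. *)
Let dense_thin v e : 0 < e -> dense (~` closure (wide v e)).
Proof.
move=> e0 W W0 oW; apply: contrapT => WO.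
have {WO} WB x : W x -> closure (wide v e) x.
  by move=> Wx; apply: contrapT => nx; apply: WO; exists x.
have [w Ww] := W0.
have [x [[Dx _] Wx]] := WB w Ww W (open_nbhs_nbhs (conj oW Ww)).
have [r [r0 rWD]] := open_ballP (openI oW oD) (conj Wx Dx).
have K0 : 0 < `|v| + 1 by rewrite ltr_wpDl.
pose h := (r / (`|v| + 1)) *: v.
have c0 : 0 < r / (`|v| + 1) by exact: divr_gt0.
have hr : `|h| < r.
  rewrite normrZ gtr0_norm// mulrAC ltr_pdivrMr// ltr_pM2l//; lra.
have seg t : 0 <= t <= 1 -> wide v e (x + t *: h).
  move=> t01; have [] := rWD (x + t *: h) _.
    by apply: segment_ball => //; [rewrite subrr normr0|rewrite addrAC subrr add0r].
  by move=> /WB cl /closure_wide; exact.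
have [_ [_ [_ Jc]]] := Jcons.
have [t [t01 [_ [_ Jt]]]] := ae_lebesgue_exists
  (Jc _ (abs_cont_segment x h) (fun t t01 => (seg t t01).1)).
have [_ [A [[Jl Jr]]]] := seg t t01.
have /eqP := etrans (esym (Jt _ Jl)) (Jt _ Jr).
have [_ ->] := is_derive_segment x h t.
rewrite -subr_eq0 -mulmxBl -scalemxAr -mulmx_col_mx_opp scaler_eq0 gt_eqF//=.
by move=> /eqP ->; rewrite normr0 leNgt e0.
Qed.

Lemma conservative_singleton_dense (z : 'cV[R]_N) (e : R) : D z -> 0 < e ->
  exists s, [/\ D s, `|s - z| < e & forall M M', J s M -> J s M' -> M = M'].
Proof.
move=> Dz e0.
(* Pairs of a basis vector and a precision are coded by integers to get a countable family; integers
   that code nothing contribute the whole space. *)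
pose U (c : nat) : set 'cV[R]_N :=
  if (unpickle c : option ('I_N * nat)%type) is Some (i, a)
  then ~` closure (wide (delta_mx i 0) a.+1%:R^-1) else setT.
have /(@Baire R 'cV[R]_N) dU : forall c, open (U c) /\ dense (U c).
  move=> c; rewrite /U; case: (unpickle c) => [[i a]|].
    split; last by apply: dense_thin; rewrite invr_gt0.
    exact/closed_openC/closed_closure.
  by split; [exact: openT|move=> W [w Ww] _; exists w].
have [r [r0 rD]] := open_ballP oD Dz.
have oB : open [set y | `|y - z| < Num.min r e].
  rewrite openE => y /= yz; apply/nbhs_ballP.
  exists (Num.min r e - `|y - z|) => /=; first by rewrite subr_gt0.
  move=> x; rewrite mx_norm_ball /ball_/= distrC => xy.
  rewrite -(subrKA y); apply: le_lt_trans (ler_normD _ _) _; lra.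
have [|s [/= sz Us]] := dU _ _ oB.
  by exists z; rewrite /= subrr normr0 lt_min r0.
move: sz; rewrite lt_min => /andP[/rD Ds se].
exists s; split=> // M M' JM JM'.
suff E i : (M - M') *m delta_mx i (0 : 'I_1) = 0.
  by apply/matrixP => a i; have /matrixP/(_ a 0) := E i; rewrite -colE !mxE => /subr0_eq.
apply/eqP; rewrite -normr_le0 leNgt; apply/negP => n0.
have [a _ /(_ a (leqnn a))] : \forall a \near \oo,
    a.+1%:R^-1 < `|(M - M') *m delta_mx i (0 : 'I_1)|.
  have /cvg_seqP/(_ _ n0)[K hK] := @cvg_harmonic R.
  by exists K => // c /hK; rewrite subr0 ger0_norm ?invr_ge0.
move=> /= /ltW ha; have := Us (pickle (i, a)) I; rewrite /U pickleK; apply.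
apply: subset_closure; split=> //; exists (row_mx M M').
rewrite mulmx_col_mx_opp row_mxKl row_mxKr; split=> //.
by split; rewrite ?row_mxKl ?row_mxKr.
Qed.

End SingletonDense.

(** At a point where [J] is the singleton [M], nearby elements of [J] are close to [M], so [M]
    approximates [F] to first order. *)
Lemma conservative_differentiable_dense (R : realType) N k (D : set 'cV[R]_N)
    (F : 'cV[R]_N -> 'cV[R]_k) (J : 'cV[R]_N -> set 'M[R]_(k, N)) (z : 'cV[R]_N) (e : R) :
  open D -> locally_lipschitz D F -> conservative_jacobian D F J -> D z -> 0 < e ->
  exists s, `|s - z| < e /\ differentiable F s.
Proof.
move=> oD FL Jcons Dz e0.
have [s [Ds sz Js]] := conservative_singleton_dense oD Jcons Dz e0.
have [Jne _] := Jcons; have [M JM] := Jne s Ds.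
exists s; split=> //; apply: (@differentiable_of_linear_approx _ _ _ _ _ M) => a a0.
have K0 : 0 < N%:R + 1 :> R by rewrite ltr_wpDl.
(* With [1%:M] as test matrix the open set is a ball around [M]; its radius absorbs the factor [N]
   of [mx_norm_mulmx_le]. *)
have [|d [d0 hd]] := conservative_increment oD FL Jcons Ds
    (@open_mulmx_close R k N N 1%:M M (a / (N%:R + 1))).
  by move=> M' JM' /=; rewrite mulmx1 (Js _ _ JM' JM) subrr normr0 divr_gt0.
exists d; split=> // h hh; apply: hd; rewrite ?subrr ?normr0//.
  by rewrite addrAC subrr add0r.
move=> M'; rewrite /= mulmx1 ltr_pdivlMr// -mulmxBl => M'M.
apply: le_trans (mx_norm_mulmx_le _ _) _; apply: ler_wpM2r => //.
have := normr_ge0 (M' - M); lra.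
Qed.

Lemma clarke_lim_nonempty (R : realType) N k (D : set 'cV[R]_N)
    (F : 'cV[R]_N -> 'cV[R]_k) (J : 'cV[R]_N -> set 'M[R]_(k, N)) (z : 'cV[R]_N) :
  open D -> locally_lipschitz D F -> conservative_jacobian D F J -> D z ->
  clarke_lim F z !=set0.
Proof.
move=> oD FL Jcons Dz; have [r [r0 [L hL]]] := FL z Dz.
have [s hs] := choice (fun j : nat => conservative_differentiable_dense oD FL Jcons Dz
  (divr_gt0 r0 (ltr0Sn R j))).
have [|f [M [fi fM]]] := @mx_bolzano_weierstrass R k N (fun j => jac F (s j)) `|L|.
  move=> j; have [sz sd] := hs j; apply: jac_norm_le hL _ sd.
  apply: lt_le_trans sz _; rewrite ler_pdivrMr//.
  by rewrite ler_peMr ?ler1n// ltW.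
exists M, (s \o f); split; first by move=> j; have [] := hs (f j).
split=> //; apply: cvg_subseq fi _.
by apply: (cvg_seq_harmonic r0) => j; have [] := hs j.
Qed.

Lemma clarke_jac_lim (R : realType) N k (F : 'cV[R]_N -> 'cV[R]_k) (z : 'cV[R]_N) :
  clarke_lim F z `<=` clarke_jac F z.
Proof.
move=> M FM; exists 1, (fun=> 1), (fun=> M).
by rewrite !big_ord1 scale1r.
Qed.

(** * Caratheodory's theorem and the closed graph of the Clarke Jacobian *)

(** The rows [(1, a i)] outnumber their [d + 1] columns, so they are linearly dependent; the column
    of ones makes the coefficients sum to 0. A nonzero vector of sum 0 has a positive entry. *)
Lemma affine_dependence (R : realFieldType) d q (a : 'I_q -> 'rV[R]_d) :
  (d.+1 < q)%N ->
  exists mu : 'I_q -> R, [/\ exists i, 0 < mu i, \sum_i mu i = 0 &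
    \sum_i mu i *: a i = 0].
Proof.
move=> dq; pose A : 'M[R]_(q, 1 + d) := \matrix_i row_mx 1%:M (a i).
have : kermx A != 0.
  rewrite kermx_eq0 -row_leq_rank -ltnNge.
  by apply: leq_ltn_trans (rank_leq_col A) _; rewrite add1n.
move=> /rowV0Pn[mu /sub_kermxP muA mu0].
have muE : \sum_i mu 0 i *: row_mx 1%:M (a i) = 0 :> 'rV[R]_(1 + d).
  by rewrite -[RHS]muA mulmx_sum_row; apply: eq_bigr => i _; rewrite rowK.
have s0 : \sum_i mu 0 i = 0.
  have /(congr1 lsubmx) := muE; rewrite linear_sum linear0 /= => /matrixP/(_ 0 0).
  rewrite summxE [RHS]mxE => h; rewrite -[RHS]h.
  by apply: eq_bigr => i _; rewrite linearZ/= row_mxKl !mxE mulr1.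
exists (mu 0); split=> //.
- apply: contrapT => npos; move/negP: mu0; apply; apply/eqP/rowP => i.
  rewrite mxE; have neg j : mu 0 j <= 0.
    by rewrite leNgt; apply/negP => h; apply: npos; exists j.
  apply/eqP; have /eqP := s0; rewrite -oppr_eq0 -sumrN psumr_eq0; last first.
    by move=> j _; rewrite oppr_ge0.
  by move=> /allP/(_ i); rewrite mem_index_enum oppr_eq0 => /(_ isT).
- have /(congr1 rsubmx) := muE; rewrite linear_sum linear0 /= => h; rewrite -[RHS]h.
  by apply: eq_bigr => i _; rewrite linearZ/= row_mxKr.
Qed.

(** Weights are moved along an affine dependence until one vanishes, and induction removes that
    point. Exactly [d + 1] points are produced, so that later the number of terms is the same along
    a whole sequence. *)
Lemma caratheodory (R : realFieldType) d q (a : 'I_q -> 'rV[R]_d) (w : 'I_q -> R) :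
  (forall i, 0 <= w i) -> \sum_i w i = 1 ->
  exists (f : 'I_d.+1 -> 'I_q) (w' : 'I_d.+1 -> R),
    [/\ forall i, 0 <= w' i, \sum_i w' i = 1 &
        \sum_i w' i *: a (f i) = \sum_i w i *: a i].
Proof.
elim: q a w => [|q IH] a w w0 w1.
  by move: w1; rewrite big_ord0 => /eqP; rewrite eq_sym oner_eq0.
have [qd|dq] := leqP q.+1 d.+1.
  have E (V : nmodType) (G : 'I_q.+1 -> V) :
      \sum_(i < d.+1) (if (i < q.+1)%N then G (inord i) else 0) = \sum_i G i.
    have -> : \sum_i G i = \sum_(i < q.+1) (fun j : nat => G (inord j)) i.
      by apply: eq_bigr => i _; rewrite inord_val.
    by rewrite (big_ord_widen d.+1 (fun j : nat => G (inord j)) qd) [RHS]big_mkcond.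
  (* A short family is padded with zero weights, which make the default values of [inord]
     harmless. *)
  exists (fun i => inord i), (fun i => if (i < q.+1)%N then w (inord i) else 0).
  split=> [i||]; first by case: ifP.
  - by rewrite E.
  - rewrite -[RHS]E; apply: eq_bigr => i _; case: ifP => // _; exact: scale0r.
have [mu [[i1 mu1] mus mua]] := affine_dependence a dq.
(* The smallest ratio [w i / mu i] over positive [mu i] is the largest shift that keeps all weights
   nonnegative. *)
have [i0 mu0 min0] := @arg_minP _ R _ i1 (fun i => 0 < mu i) (fun i => w i / mu i) mu1.
pose t := w i0 / mu i0.
have t0 : 0 <= t by rewrite divr_ge0// ltW.
pose w' i := w i - t * mu i.
have w'0 i : 0 <= w' i.
  rewrite subr_ge0; have [mui|mui] := ltP 0 (mu i).
    by rewrite -ler_pdivlMr//; exact: min0.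
  by apply: le_trans (w0 i); rewrite mulr_ge0_le0.
have w'i0 : w' i0 = 0 by rewrite /w' /t divfK ?subrr// gt_eqF.
have w's : \sum_i w' i = 1 by rewrite sumrB w1 -mulr_sumr mus mulr0 subr0.
have w'a : \sum_i w' i *: a i = \sum_i w i *: a i.
  under eq_bigr do rewrite scalerBl -scalerA.
  by rewrite sumrB -scaler_sumr mua scaler0 subr0.
have [||f [w2 [w20 w2s w2a]]] := IH (fun j => a (lift i0 j)) (fun j => w' (lift i0 j)).
- by move=> j; exact: w'0.
- by rewrite -[RHS]w's (bigD1_ord i0)//= w'i0 add0r.
exists (lift i0 \o f), w2; split=> //=.
by rewrite w2a -w'a [RHS](bigD1_ord i0)//= w'i0 scale0r add0r.
Qed.

Lemma clarke_jac_caratheodory (R : realType) N k (F : 'cV[R]_N -> 'cV[R]_k)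
    (z : 'cV[R]_N) M :
  clarke_jac F z M -> exists (w : 'I_(k * N).+1 -> R) (Ms : 'I_(k * N).+1 -> 'M[R]_(k, N)),
    [/\ forall i, 0 <= w i, \sum_i w i = 1, forall i, clarke_lim F z (Ms i) &
        M = \sum_i w i *: Ms i].
Proof.
move=> [q [w [Ms [w0 [w1 [hMs ->]]]]]].
have [f [w' [w'0 w'1 w'a]]] := caratheodory (fun i => mxvec (Ms i)) w0 w1.
exists w', (Ms \o f); split; [exact: w'0|exact: w'1|by move=> i; exact: hMs|].
apply: (can_inj mxvecK); rewrite !linear_sum/=.
under eq_bigr do rewrite linearZ/=.
by under [RHS]eq_bigr do rewrite linearZ/=.
Qed.

Lemma cvg_seq_close (R : realType) (V : normedModType R) (u v : nat -> V) (l : V) :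
  u @ \oo --> l -> (forall j, `|v j - u j| < j.+1%:R^-1) -> v @ \oo --> l.
Proof.
move=> ul vu; have -> : v = (fun j => u j + (v j - u j)).
  by apply/funext => j; rewrite addrC subrK.
rewrite -[l]addr0; apply: cvgD => //.
by apply: (@cvg_seq_harmonic R V _ _ 1) => // j; rewrite subr0 div1r.
Qed.

(** Diagonal argument: for each [j], one point of differentiability is within [1 / (j + 1)] of
    [zs j] while its Jacobian is within [1 / (j + 1)] of [Ms j]. *)
Lemma clarke_lim_closed (R : realType) N k (F : 'cV[R]_N -> 'cV[R]_k)
    (zs : nat -> 'cV[R]_N) (Ms : nat -> 'M[R]_(k, N)) (z : 'cV[R]_N) (M : 'M[R]_(k, N)) :
  (forall j, clarke_lim F (zs j) (Ms j)) -> zs @ \oo --> z -> Ms @ \oo --> M ->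
  clarke_lim F z M.
Proof.
move=> H zsz MsM.
have H' j : exists s, [/\ differentiable F s, `|s - zs j| < j.+1%:R^-1 &
    `|jac F s - Ms j| < j.+1%:R^-1].
  have [s [sd [/cvg_seqP sz /cvg_seqP sM]]] := H j.
  have j0 : 0 < j.+1%:R^-1 :> R by rewrite invr_gt0.
  have [K1 h1] := sz _ j0; have [K2 h2] := sM _ j0.
  exists (s (maxn K1 K2)); split=> //; first by apply: h1; exact: leq_maxl.
  by apply: h2; exact: leq_maxr.
have [s hs] := choice H'; exists s; split; first by move=> j; have [] := hs j.
by split; [apply: cvg_seq_close zsz _|apply: cvg_seq_close MsM _] => j; have [] := hs j.
Qed.

Lemma cvg_sum_seq (R : realType) (I : finType) (u : I -> nat -> R) (l : I -> R) :
  (forall i, u i @ \oo --> l i) -> (fun j => \sum_i u i j) @ \oo --> \sum_i l i.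
Proof.
move=> ul; apply: cvg_big => //; exact: add_continuous.
Qed.

(** With a number of terms fixed by [k] and [N], the bounded weights and limiting Jacobians converge
    along a common subsequence, and the limit is again a convex combination. *)
Lemma clarke_jac_closed (R : realType) N k (D : set 'cV[R]_N) (F : 'cV[R]_N -> 'cV[R]_k) :
  locally_lipschitz D F -> closed_graph_map D (clarke_jac F).
Proof.
move=> FL zs Ms z M H zsz MsM Dz; have [r [r0 [L hL]]] := FL z Dz.
have /cvg_seqP/(_ r r0)[K hK] := zsz.
have shift_incr : increasing_seq (addn K) by move=> a b; exact: leq_add2l.
have {H} H j := clarke_jac_caratheodory (H (K + j)%N).2.
have {H}[w H] := choice H.
have {H}[A H] := choice H.
(* One finite family holds both the weights ([None]) and the matrix entries ([Some]), so that a
   single extraction serves all. *)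
pose u (x : 'I_(k * N).+1 * option ('I_k * 'I_N)) (j : nat) : R :=
  if x.2 is Some (a, b) then A j x.1 a b else w j x.1.
have [|f [l [fi fl]]] := @finite_bolzano_weierstrass R _ u (Num.max 1 `|L|).
  move=> [i [[a b]|]] j; rewrite /u /= le_max; have [w0 w1 hA _] := H j.
    apply/orP; right; apply: le_trans (mx_norm_entry _ _ _) _.
    by apply: clarke_lim_norm_le hL _ (hA i); apply: hK; exact: leq_addr.
  by rewrite ger0_norm// -w1 (bigD1 i)//= lerDl sumr_ge0.
pose A' i : 'M[R]_(k, N) := \matrix_(a, b) l (i, Some (a, b)).
exists (k * N).+1, (fun i => l (i, None)), A'; split.
  move=> i; apply: cvgr_to_ge (fl (i, None)) _; apply: nearW => j.
  by have [w0 _ _ _] := H (f j); exact: w0.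
split.
  have h1 := cvg_sum_seq (fun i => fl (i, None)).
  apply: (cvg_unique (@norm_hausdorff R R) h1).
  apply: (@cvg_trans _ ((fun=> 1 : R) @ \oo)); last exact: cvg_cst.
  apply: near_eq_cvg; apply: nearW => j /=.
  by have [_ <- _ _] := H (f j).
split.
  move=> i; apply: (@clarke_lim_closed R N k F (fun j => zs (K + f j)%N)
    (fun j => A (f j) i)).
  - by move=> j; have [] := H (f j).
  - exact: (cvg_subseq fi (cvg_subseq shift_incr zsz)).
  - by apply/mx_cvg_seqP => a b; rewrite mxE; exact: fl (i, Some (a, b)).
apply/matrixP => a b; rewrite summxE.
have /mx_cvg_seqP/(_ a b) h1 := cvg_subseq fi (cvg_subseq shift_incr MsM).
apply: (cvg_unique (@norm_hausdorff R R) h1).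
have -> : (fun j => ((Ms \o addn K) \o f) j a b) =
    (fun j => \sum_i (w (f j) i * A (f j) i a b)).
  apply/funext => j /=; have [_ _ _ ->] := H (f j).
  by rewrite summxE; apply: eq_bigr => i _; rewrite mxE.
apply: cvg_sum_seq => i; rewrite !mxE.
by apply: cvgM; [exact: fl (i, None)|exact: fl (i, Some (a, b))].
Qed.

(** * The saddle operator and its resolvent *)

Section EuclideanProduct.
Context {R : realType}.

Lemma dotcC N (u v : 'cV[R]_N) : dotc u v = dotc v u.
Proof. by apply: eq_bigr => i _; rewrite mulrC. Qed.

Lemma dotcDl N (u v w : 'cV[R]_N) : dotc (u + v) w = dotc u w + dotc v w.
Proof. by rewrite -big_split; apply: eq_bigr => i _; rewrite mxE mulrDl. Qed.

Lemma dotcZl N (a : R) (u w : 'cV[R]_N) : dotc (a *: u) w = a * dotc u w.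
Proof. by rewrite mulr_sumr; apply: eq_bigr => i _; rewrite mxE mulrA. Qed.

Lemma dotcNl N (u w : 'cV[R]_N) : dotc (- u) w = - dotc u w.
Proof. by rewrite -scaleN1r dotcZl mulN1r. Qed.

Lemma dotcBl N (u v w : 'cV[R]_N) : dotc (u - v) w = dotc u w - dotc v w.
Proof. by rewrite dotcDl dotcNl. Qed.

Lemma dotcZr N (a : R) (u w : 'cV[R]_N) : dotc u (a *: w) = a * dotc u w.
Proof. by rewrite dotcC dotcZl dotcC. Qed.

Lemma dotcNr N (u w : 'cV[R]_N) : dotc u (- w) = - dotc u w.
Proof. by rewrite dotcC dotcNl dotcC. Qed.

Lemma dotcBr N (u v w : 'cV[R]_N) : dotc u (v - w) = dotc u v - dotc u w.
Proof. by rewrite dotcC dotcBl dotcC (dotcC w). Qed.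

Lemma dotc_sumr N (I : finType) (u : 'cV[R]_N) (f : I -> 'cV[R]_N) :
  dotc u (\sum_i f i) = \sum_i dotc u (f i).
Proof.
rewrite /dotc exchange_big/=; apply: eq_bigr => a _.
by rewrite summxE mulr_sumr.
Qed.

Lemma dotc_split n m (u v : 'cV[R]_(n + m)) :
  dotc u v = dotc (usubmx u) (usubmx v) + dotc (dsubmx u) (dsubmx v).
Proof.
by rewrite /dotc big_split_ord; congr (_ + _); apply: eq_bigr => i _; rewrite !mxE.
Qed.

Lemma sqn_ge0 N (u : 'cV[R]_N) : 0 <= sqn u.
Proof. by apply: sumr_ge0 => i _; rewrite -expr2 sqr_ge0. Qed.

Lemma sqn_norm_ge N (u : 'cV[R]_N) : `|u| ^+ 2 <= sqn u.
Proof.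
have s0 := sqn_ge0 u.
rewrite -(sqr_sqrtr s0) ler_pXn2r ?nnegrE ?sqrtr_ge0//.
apply: mx_norm_le => [|i j]; first exact: sqrtr_ge0.
rewrite (ord1 j) -sqrtr_sqr ler_wsqrtr// /sqn /dotc (bigD1 i)//= -expr2 lerDl.
by apply: sumr_ge0 => a _; rewrite -expr2 sqr_ge0.
Qed.

Lemma sqn_norm_le N (u : 'cV[R]_N) : sqn u <= N%:R * `|u| ^+ 2.
Proof.
apply: (@le_trans _ _ (\sum_(i < N) `|u| ^+ 2)).
  apply: ler_sum => i _; rewrite -expr2 -[leLHS]ger0_norm ?sqr_ge0// normrX.
  by rewrite ler_pXn2r ?nnegrE// mx_norm_entry.
by rewrite sumr_const card_ord mulr_natl.
Qed.

Lemma sqn_eq0 N (u : 'cV[R]_N) : sqn u <= 0 -> u = 0.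
Proof.
move=> u0; apply/eqP; rewrite -normr_eq0 -sqrf_eq0 eq_le sqr_ge0 andbT.
exact: le_trans (sqn_norm_ge u) u0.
Qed.

Lemma sqnZ N (a : R) (u : 'cV[R]_N) : sqn (a *: u) = a ^+ 2 * sqn u.
Proof. by rewrite /sqn dotcZl dotcZr mulrA. Qed.

Lemma sqnB N (u v : 'cV[R]_N) : sqn (u - v) = sqn u - 2 * dotc u v + sqn v.
Proof. rewrite /sqn dotcBl !dotcBr (dotcC v u); ring. Qed.

Lemma sqnBC N (u v : 'cV[R]_N) : sqn (u - v) = sqn (v - u).
Proof. by rewrite -opprB /sqn dotcNl dotcNr opprK. Qed.

(* The right-hand side is affine in [u], so sublevel sets of [sqn] are stable
   under convex combinations and limits. *)
Lemma sqn_leP N (u : 'cV[R]_N) (c : R) :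
  sqn u <= c <-> forall y, 2 * dotc y u - sqn y <= c.
Proof.
split=> [uc y|/(_ u)]; last by rewrite /sqn; lra.
by have := sqn_ge0 (y - u); rewrite sqnB; lra.
Qed.

Lemma sqn_convex N q (w : 'I_q -> R) (u : 'I_q -> 'cV[R]_N) (c : R) :
  (forall i, 0 <= w i) -> \sum_i w i = 1 -> (forall i, sqn (u i) <= c) ->
  sqn (\sum_i w i *: u i) <= c.
Proof.
move=> w0 w1 uc; apply/sqn_leP => y.
have -> : 2 * dotc y (\sum_i w i *: u i) - sqn y = \sum_i w i * (2 * dotc y (u i) - sqn y).
  under [RHS]eq_bigr do rewrite mulrBr mulrCA.
  rewrite sumrB -mulr_suml w1 mul1r -mulr_sumr dotc_sumr.
  by under eq_bigr do rewrite dotcZr.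
have -> : c = \sum_i w i * c by rewrite -mulr_suml w1 mul1r.
apply: ler_sum => i _; apply: ler_wpM2l => //.
by have /sqn_leP/(_ y) := uc i.
Qed.

Lemma dotc_le N (u v : 'cV[R]_N) : dotc u v <= N%:R * `|u| * `|v|.
Proof.
apply: (@le_trans _ _ (\sum_(i < N) `|u| * `|v|)).
  apply: ler_sum => i _; apply: le_trans (ler_norm _) _.
  by rewrite normrM ler_pM// mx_norm_entry.
by rewrite sumr_const card_ord -mulrA mulr_natl.
Qed.

Lemma cvg_sqn_le N (u : nat -> 'cV[R]_N) (l : 'cV[R]_N) (c : R) :
  u @ \oo --> l -> (exists K, forall j, (K <= j)%N -> sqn (u j) <= c) -> sqn l <= c.
Proof.
move=> /cvg_seqP ul [K hK]; apply/sqn_leP => y; apply/ler_addgt0Pr => e e0.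
have K0 : 0 < 2 * (N%:R * `|y|) + 1 by rewrite ltr_wpDl// !mulr_ge0.
have [K' hK'] := ul _ (divr_gt0 e0 K0).
have := hK' _ (leq_maxr K K'); rewrite ltr_pdivlMr// => h1.
have /sqn_leP/(_ y) h2 := hK _ (leq_maxl K K').
have := dotc_le y (l - u (maxn K K')); rewrite dotcBr distrC.
have := normr_ge0 (u (maxn K K') - l); lra.
Qed.

(** Expanding gives [(1 - q) * sqn e <= 2 * dotc e d - sqn d]; nonnegativity of the square of
    [(1 - q) *: e - 2 *: d] then replaces Cauchy-Schwarz. *)
Lemma contraction_sqn_le N (q : R) (e d : 'cV[R]_N) :
  0 <= q < 1 -> sqn (e - d) <= q * sqn e -> (1 - q) ^+ 2 * sqn e <= 4 * sqn d.
Proof.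
move=> /andP[q0 q1]; rewrite sqnB => h.
have c0 : 0 <= 1 - q by lra.
have h1 : (1 - q) * ((1 - q) * sqn e) <= (1 - q) * (2 * dotc e d - sqn d).
  by apply: ler_wpM2l => //; lra.
have := sqn_ge0 ((1 - q) *: e - 2 *: d); rewrite sqnB !sqnZ dotcZl dotcZr.
have : 0 <= (1 - q) * sqn d by rewrite mulr_ge0// sqn_ge0.
lra.
Qed.

(** Passing to the max-norm costs a factor [N] under the square, and [N.+1] is an upper bound for
    its root. *)
Lemma contraction_norm_le N (q : R) (e d : 'cV[R]_N) :
  0 <= q < 1 -> sqn (e - d) <= q * sqn e -> (1 - q) * `|e| <= 2 * N.+1%:R * `|d|.
Proof.
move=> q01 /(contraction_sqn_le q01) h; have /andP[q0 q1] := q01.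
have c0 : 0 <= 1 - q by lra.
rewrite -(@ler_pXn2r _ 2) ?nnegrE ?mulr_ge0// !exprMn.
apply: (@le_trans _ _ ((1 - q) ^+ 2 * sqn e)).
  by rewrite ler_wpM2l ?sqr_ge0// sqn_norm_ge.
apply: le_trans h _; have := sqn_norm_le d => h.
apply: (@le_trans _ _ (4 * (N%:R * `|d| ^+ 2))); first by rewrite ler_wpM2l.
rewrite mulrA ler_wpM2r ?sqr_ge0//.
have -> : 2 ^+ 2 = 4 :> R by ring.
rewrite ler_wpM2l// -natrX ler_nat -mulnn mulSn.
exact: leq_trans (leqnSn N) (leq_addr _ _).
Qed.

End EuclideanProduct.

Section Saddle.
Context {R : realType}.

Lemma convex_set_midpoint N (X : set 'cV[R]_N) (x y : 'cV[R]_N) :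
  convex_set X -> X x -> X y -> X (2^-1 *: x + (1 - 2^-1) *: y).
Proof.
move=> cX Xx Xy.
have h0 : 0 <= (2^-1 : R) by rewrite invr_ge0.
have h1 : (2^-1 : R) <= 1 by rewrite invf_le1// ler1n.
by have /set_mem := cX x y (Itv01 h0 h1) (mem_set Xx) (mem_set Xy).
Qed.

(** Strong convexity is combined with the subgradient inequality at [t *: x' + (1 - t) *: x];
    dividing by [t] leaves an error of order [t]. *)
Lemma strongly_convex_subdiff N (a : R) (f : 'cV[R]_N -> R) (x x' g : 'cV[R]_N) :
  strongly_convex a f -> subdiff f x g ->
  f x + dotc g (x' - x) + a / 2 * sqn (x' - x) <= f x'.
Proof.
move=> cf gx; apply/ler_addgt0Pr => e e0.
pose S := a / 2 * sqn (x' - x).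
have K0 : 0 < `|S| + 1 by rewrite ltr_wpDl.
pose t := Num.min 1 (e / (`|S| + 1)).
have t0 : 0 < t by rewrite lt_min ltr01 divr_gt0.
have t1 : t <= 1 by rewrite ge_min lexx.
have te : t * (`|S| + 1) <= e by rewrite -ler_pdivlMr// ge_min lexx orbT.
have := cf x' x t; rewrite (ltW t0) t1 => /(_ isT) h1.
have := gx (t *: x' + (1 - t) *: x).
have -> : t *: x' + (1 - t) *: x - x = t *: (x' - x).
  by rewrite scalerBl scale1r scalerBr addrA addrAC addrK.
rewrite dotcZr => h2.
have h3 : t * (f x + dotc g (x' - x) + S * (1 - t)) <= t * f x'.
  by rewrite /S; lra.
move: h3; rewrite ler_pM2l// -/S => h3.
have : S * t <= `|S| * t by apply: ler_wpM2r; [exact: ltW|exact: ler_norm].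
lra.
Qed.

Lemma normal_cone_monotone N (X : set 'cV[R]_N) (x x' v v' : 'cV[R]_N) :
  normal_cone X x v -> normal_cone X x' v' -> 0 <= dotc (v - v') (x - x').
Proof.
move=> [Xx hv] [Xx' hv']; have := hv x' Xx'; have := hv' x Xx.
rewrite dotcBl !dotcBr; lra.
Qed.

Variables (n m : nat) (Phi : 'cV[R]_n -> 'cV[R]_m -> R).
Variables (X : set 'cV[R]_n) (Y : set 'cV[R]_m) (alpha : R).
Hypothesis Phi_x : forall y, strongly_convex alpha (fun x => Phi x y).
Hypothesis Phi_y : forall x, strongly_convex alpha (fun y => - Phi x y).

(** Each block gives two strengthened subgradient inequalities. In the sum of the four, the values
    of [Phi] at the four corners cancel, and each quadratic term with factor [alpha / 2] occurs
    twice. *)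
Lemma saddle_op_strongly_monotone (z z' a a' : 'cV[R]_(n + m)) :
  saddle_op Phi X Y z a -> saddle_op Phi X Y z' a' ->
  alpha * sqn (z - z') <= dotc (a - a') (z - z').
Proof.
move=> [[g [v [gx [vx ag]]]] [h [w [hy [wy ah]]]]].
move=> [[g' [v' [gx' [vx' ag']]]] [h' [w' [hy' [wy' ah']]]]].
have h1 := strongly_convex_subdiff (usubmx z') (Phi_x (dsubmx z)) gx.
have h2 := strongly_convex_subdiff (usubmx z) (Phi_x (dsubmx z')) gx'.
have h3 := strongly_convex_subdiff (dsubmx z') (Phi_y (usubmx z)) hy.
have h4 := strongly_convex_subdiff (dsubmx z) (Phi_y (usubmx z')) hy'.
have h5 := normal_cone_monotone vx vx'.
have h6 := normal_cone_monotone wy wy'.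
rewrite /sqn !dotc_split !linearB/= ag ah ag' ah' -!/(sqn _).
move: h1 h2 h3 h4 h5 h6.
rewrite (sqnBC (usubmx z') (usubmx z)) (sqnBC (dsubmx z') (dsubmx z)).
rewrite !(dotcBl, dotcDl, dotcBr); lra.
Qed.

(** Strong monotonicity gives [k * sqn (w - w') <= dotc (z - z') (w - w')] with
    [k = 1 + gamma * alpha]; expanding the square of [u - k *: v] turns this into the bound. *)
Lemma resolvent_contraction (gamma : R) (z z' w w' : 'cV[R]_(n + m)) :
  0 < alpha -> 0 < gamma ->
  is_resolvent (saddle_op Phi X Y) gamma z w ->
  is_resolvent (saddle_op Phi X Y) gamma z' w' ->
  sqn (w - w') <= (1 + gamma * alpha) ^- 2 * sqn (z - z').
Proof.
move=> a0 g0 [a [Aa za]] [a' [Aa' za']].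
have mono := saddle_op_strongly_monotone Aa Aa'.
have k0 : 0 < 1 + gamma * alpha by rewrite ltr_wpDl// mulr_gt0.
rewrite ler_pdivlMl ?exprn_gt0//.
have E : z - z' = (w - w') + gamma *: (a - a').
  rewrite scalerBr -za -za'.
  by apply/matrixP => i j; rewrite !mxE; ring.
set k := 1 + gamma * alpha in k0 *.
have h1 : k * sqn (w - w') <= dotc (z - z') (w - w').
  rewrite E dotcDl dotcZl /k mulrDl mul1r lerD2l -mulrA.
  by apply: ler_wpM2l => //; exact: ltW.
have h2 : k * (k * sqn (w - w')) <= k * dotc (z - z') (w - w').
  by apply: ler_wpM2l => //; exact: ltW.
move: h2; set u := z - z'; set v := w - w' => h2.
have := sqn_ge0 (u - k *: v); rewrite sqnB sqnZ dotcZr; lra.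
Qed.

(** In each block the subgradient is opposite to the normal vector, so the normal-cone inequality
    gives optimality over the set. The converse will come from uniqueness: the fixed point found
    later is a zero, hence the only saddle point. *)
Lemma saddle_op_zero_saddle (z : 'cV[R]_(n + m)) :
  saddle_op Phi X Y z 0 -> is_saddle Phi X Y z.
Proof.
move=> [[g [v [gx [[Xx vx] gv]]]] [h [w [hy [[Yy wy] hw]]]]].
split=> //; split=> // x y Xx' Yy'.
have gE : g = - v by apply/eqP; rewrite -addr_eq0 -gv linear0.
have hE : h = - w by apply/eqP; rewrite -addr_eq0 -hw linear0.
have := gx x; have := hy y; have := vx x Xx'; have := wy y Yy'.
rewrite gE hE !dotcNl; lra.
Qed.

(** Saddle points come without subgradients, so each is tested against midpoints with the other. The
    four inequalities add up to [alpha * sqn (z - z') <= 0]. *)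
Lemma saddle_unique (z z' : 'cV[R]_(n + m)) :
  0 < alpha -> convex_set X -> convex_set Y ->
  is_saddle Phi X Y z -> is_saddle Phi X Y z' -> z = z'.
Proof.
move=> a0 cX cY [Xx [Yy hz]] [Xx' [Yy' hz']].
have half : 0 <= (2^-1 : R) <= 1 by rewrite invr_ge0 ler0n invf_le1// ler1n.
have h1 := Phi_x (dsubmx z) (usubmx z) (usubmx z') half.
have h2 := Phi_y (usubmx z) (dsubmx z) (dsubmx z') half.
have h3 := Phi_x (dsubmx z') (usubmx z') (usubmx z) half.
have h4 := Phi_y (usubmx z') (dsubmx z') (dsubmx z) half.
have [_ k1] := hz _ _ (convex_set_midpoint cX Xx Xx') Yy.
have [k2 _] := hz _ _ Xx (convex_set_midpoint cY Yy Yy').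
have [_ k3] := hz' _ _ (convex_set_midpoint cX Xx' Xx) Yy'.
have [k4 _] := hz' _ _ Xx' (convex_set_midpoint cY Yy' Yy).
have sx0 := sqn_ge0 (usubmx z - usubmx z').
have sy0 := sqn_ge0 (dsubmx z - dsubmx z').
have : alpha * sqn (z - z') <= 0.
  rewrite /sqn dotc_split !linearB/= -!/(sqn _).
  move: h3 h4; rewrite (sqnBC (usubmx z')) (sqnBC (dsubmx z')) => h3 h4; lra.
by rewrite pmulr_rle0// => /sqn_eq0/subr0_eq.
Qed.

End Saddle.

(* A map that contracts the Euclidean norm need not contract the max-norm of
   the library, but one of its iterates does. *)
Lemma sqn_contraction_fixpoint (R : realType) N (f : 'cV[R]_N -> 'cV[R]_N) (q : R) :
  0 <= q < 1 -> (forall x y, sqn (f x - f y) <= q * sqn (x - y)) ->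
  exists x, f x = x.
Proof.
move=> /andP[q0 q1] fq.
have iterq k x y : sqn (iter k f x - iter k f y) <= q ^+ k * sqn (x - y).
  elim: k => [|k IH]; first by rewrite expr0 mul1r.
  by rewrite exprS -mulrA; apply: le_trans (fq _ _) _; rewrite ler_wpM2l.
(* Since [sqn] is at most [N] times the squared max-norm, this [k] makes the iterate contract the
   max-norm by 1/2. *)
have [k hk] : exists k, q ^+ k * N%:R < 4^-1.
  have /cvg_seqP : (fun k => q ^+ k) @ \oo --> (0 : R).
    by apply: cvg_expr; rewrite ger0_norm.
  have K0 : 0 < N%:R + 1 :> R by rewrite ltr_wpDl.
  move=> /(_ (4^-1 / (N%:R + 1)))[|k hk]; first by rewrite divr_gt0.
  exists k; have := hk k (leqnn k).
  rewrite subr0 ger0_norm ?exprn_ge0// ltr_pdivlMr//; apply: le_lt_trans.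
  by rewrite ler_wpM2l ?exprn_ge0// lerDl.
pose g := iter k f.
have gfun : set_fun setT setT g by [].
pose G : {fun [set: 'cV[R]_N] >-> [set: 'cV[R]_N]} := totalfun g.
have half0 : 0 <= 2^-1 :> R by rewrite invr_ge0.
have ctr : is_contraction G.
  exists (NngNum half0); split; first by rewrite /= invf_lt1// ltr1n.
  move=> [x y] _ /=.
  rewrite -(@ler_pXn2r _ 2) ?nnegrE ?mulr_ge0// exprMn.
  apply: le_trans (sqn_norm_ge _) _; apply: le_trans (iterq k x y) _.
  apply: (@le_trans _ _ (q ^+ k * (N%:R * `|x - y| ^+ 2))).
    by rewrite ler_wpM2l ?exprn_ge0// sqn_norm_le.
  rewrite mulrA ler_wpM2r ?sqr_ge0//; apply: le_trans (ltW hk) _.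
  rewrite expr2; lra.
have [|x _ xG] := banach_fixed_point ctr closedT; first by exists 0.
(* The point [f x] is fixed by the iterate as well, and the iterate contracts the distance between
   [f x] and [x], which must vanish. *)
exists x; apply/subr0_eq/sqn_eq0.
have gx : iter k f x = x by rewrite [RHS]xG.
have := iterq k (f x) x; rewrite -iterSr iterS gx => h.
have h1 : q ^+ k * sqn (f x - x) <= q ^+ k * (N%:R * `|f x - x| ^+ 2).
  by rewrite ler_wpM2l ?exprn_ge0// sqn_norm_le.
have h2 : q ^+ k * N%:R * `|f x - x| ^+ 2 <= 4^-1 * `|f x - x| ^+ 2.
  by rewrite ler_wpM2r ?sqr_ge0// ltW.
have := sqn_norm_ge (f x - x); lra.
Qed.

(** * Fixed points of parametrized contractions *)

Lemma mx_norm_usubmx (R : realType) p N k (A : 'M[R]_(p + N, k)) : `|usubmx A| <= `|A|.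
Proof. by apply: mx_norm_le => // i j; rewrite mxE mx_norm_entry. Qed.

Lemma mx_norm_dsubmx (R : realType) p N k (A : 'M[R]_(p + N, k)) : `|dsubmx A| <= `|A|.
Proof. by apply: mx_norm_le => // i j; rewrite mxE mx_norm_entry. Qed.

Lemma mx_norm_lsubmx (R : realType) k p N (A : 'M[R]_(k, p + N)) : `|lsubmx A| <= `|A|.
Proof. by apply: mx_norm_le => // i j; rewrite mxE mx_norm_entry. Qed.

Lemma mx_norm_col_mx (R : realType) p N k (A : 'M[R]_(p, k)) (B : 'M[R]_(N, k)) :
  `|col_mx A B| = Num.max `|A| `|B|.
Proof.
apply/eqP; rewrite eq_le ge_max; apply/and3P; split.
- apply: mx_norm_le => [|i j]; first by rewrite le_max normr_ge0.
  by rewrite le_max; case: (split_ordP i) => a ->; rewrite ?col_mxEu ?col_mxEd mx_norm_entry ?orbT.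
- by rewrite -{1}(col_mxKu A B) mx_norm_usubmx.
- by rewrite -{1}(col_mxKd A B) mx_norm_dsubmx.
Qed.

Lemma col_mxB (R : realType) p N k (A A' : 'M[R]_(p, k)) (B B' : 'M[R]_(N, k)) :
  col_mx A B - col_mx A' B' = col_mx (A - A') (B - B').
Proof. by rewrite opp_col_mx add_col_mx. Qed.

Lemma cvg_col_mx (R : realType) p N k (u : nat -> 'M[R]_(p, k)) (v : nat -> 'M[R]_(N, k))
    (A : 'M[R]_(p, k)) (B : 'M[R]_(N, k)) :
  u @ \oo --> A -> v @ \oo --> B -> (fun j => col_mx (u j) (v j)) @ \oo --> col_mx A B.
Proof.
move=> /cvg_seqP uA /cvg_seqP vB; apply/cvg_seqP => e e0.
have [K1 h1] := uA e e0; have [K2 h2] := vB e e0.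
exists (maxn K1 K2) => j; rewrite geq_max => /andP[/h1 ? /h2 ?].
by rewrite col_mxB mx_norm_col_mx gt_max; apply/andP.
Qed.

Lemma open_usubmx (R : realType) p N (Theta : set 'cV[R]_p) :
  open Theta -> open [set w : 'cV[R]_(p + N) | Theta (usubmx w)].
Proof.
move=> oT; rewrite openE => w /= Tw; have [r [r0 rT]] := open_ballP oT Tw.
apply/nbhs_ballP; exists r => //= y; rewrite mx_norm_ball /ball_/= distrC => yw.
apply: rT; rewrite -linearB; exact: le_lt_trans (mx_norm_usubmx _) yw.
Qed.

Lemma abs_cont_uniform_continuous (R : realType) N (c : R -> 'cV[R]_N) (e : R) :
  abs_cont_curve c -> 0 < e ->
  exists d : R, 0 < d /\ forall s t, 0 <= s -> s <= t -> t <= 1 -> t - s < d ->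
    `|c t - c s| < e.
Proof.
move=> cac e0; have [d [d0 hd]] := cac e e0; exists d; split=> // s t s0 st t1 std.
have := hd 1%N (fun=> s) (fun=> t); rewrite !big_ord1; apply => //.
by move=> i j; rewrite !ord1 eqxx.
Qed.

(** Absolute continuity of [F \o c] asks for one constant along the whole curve. By compactness,
    pairs violating the bound with constant [j] accumulate at some [t0], against the Lipschitz
    constant near [c t0]. *)
Lemma locally_lipschitz_along_curve (R : realType) N k (D : set 'cV[R]_N)
    (F : 'cV[R]_N -> 'cV[R]_k) (c : R -> 'cV[R]_N) :
  locally_lipschitz D F -> abs_cont_curve c -> (forall t, 0 <= t <= 1 -> D (c t)) ->
  exists K d : R, [/\ 0 <= K, 0 < d & forall s t, 0 <= s -> s <= t -> t <= 1 -> t - s < d ->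
    `|F (c t) - F (c s)| <= K * `|c t - c s|].
Proof.
move=> FL cac cD; apply: contrapT => H.
have {H} H (j : nat) : exists st : R * R, [/\ 0 <= st.1, st.1 <= st.2 <= 1,
    st.2 - st.1 < j.+1%:R^-1 &
    j%:R * `|c st.2 - c st.1| < `|F (c st.2) - F (c st.1)|].
  apply: contrapT => H'; apply: H; exists j%:R, j.+1%:R^-1.
  split; [exact: ler0n|by rewrite invr_gt0|].
  move=> s t s0 st t1 std; rewrite leNgt; apply/negP => lt.
  by apply: H'; exists (s, t); rewrite /= st t1.
have [s hs] := choice H.
have [|f [l [fi fl]]] := @finite_bolzano_weierstrass R unit (fun _ j => (s j).1) 1.
  move=> _ j; have [s0 /andP[st t1] _ _] := hs j.
  by rewrite ger0_norm//; exact: le_trans t1.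
have {}fl := fl tt; set t0 := l tt in fl.
have t00 : 0 <= t0.
  apply: cvgr_to_ge fl _; apply: nearW => j /=; by have [] := hs (f j).
have t01 : t0 <= 1.
  apply: cvgr_to_le fl _; apply: nearW => j /=.
  by have [_ /andP[st t1] _ _] := hs (f j); exact: le_trans t1.
have t001 : 0 <= t0 <= 1 by rewrite t00.
have [r [r0 [L hL]]] := FL _ (cD _ t001).
have [d [d0 hd]] := abs_cont_uniform_continuous cac r0.
have near_t0 x : 0 <= x <= 1 -> `|x - t0| < d -> `|c x - c t0| < r.
  move=> /andP[x0 x1]; have [xt|/ltW tx] := leP x t0.
    by rewrite distrC ger0_norm ?subr_ge0// => h; rewrite distrC; exact: hd.
  by rewrite ger0_norm ?subr_ge0// => h; exact: hd.
have d2 : 0 < d / 2 by rewrite divr_gt0.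
have /cvg_seqP/(_ _ d2)[K1 h1] := fl.
have /cvg_seqP/(_ _ d2)[K2 h2] := @cvg_harmonic R.
have [j [jK1 jK2 jL]] : exists j, [/\ (K1 <= j)%N, (K2 <= j)%N & (Num.truncn `|L| < j)%N].
  exists (maxn (maxn K1 K2) (Num.truncn `|L|).+1).
  by split; rewrite !leq_max ?leqnn ?orbT.
have fj := increasing_seq_ge fi j.
have j1 : `|(s (f j)).1 - t0| < d / 2.
  exact: h1.
have j2 : (f j).+1%:R^-1 < d / 2.
  have := h2 (f j); rewrite subr0 ger0_norm ?invr_ge0//; apply.
  exact: leq_trans fj.
have j3 : L <= (f j)%:R.
  apply: le_trans (ler_norm _) _; apply: le_trans (ltW (truncnS_gt _)) _.
  by rewrite ler_nat; exact: leq_trans fj.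
have [s0 /andP[st t1] /lt_trans/(_ j2) std] := hs (f j).
apply/negP; rewrite -leNgt.
have hs1 : `|c (s (f j)).1 - c t0| < r.
  by apply: near_t0; [rewrite s0 (le_trans st)|lra].
have ht1 : `|c (s (f j)).2 - c t0| < r.
  apply: near_t0; first by rewrite t1 (le_trans s0).
  rewrite -(subrKA (s (f j)).1); apply: le_lt_trans (ler_normD _ _) _.
  rewrite (ger0_norm (_ : 0 <= (s (f j)).2 - _)) ?subr_ge0//; lra.
by apply: le_trans (hL _ _ ht1 hs1) _; rewrite ler_wpM2r.
Qed.

Lemma is_derive_submx (R : realType) p N (w : R -> 'cV[R]_(p + N)) (t : R) :
  derivable w t 1 ->
  is_derive t 1 (usubmx \o w) (usubmx ('D_1 w t)) /\
  is_derive t 1 (dsubmx \o w) (dsubmx ('D_1 w t)).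
Proof.
move=> dw; have dwi := (derivable_mxP _ _ _).1 dw.
have uE i j : (fun x => (usubmx \o w) x i j) = (fun x => w x (lshift N i) j).
  by apply/funext => x; rewrite /= mxE.
have dE i j : (fun x => (dsubmx \o w) x i j) = (fun x => w x (rshift p i) j).
  by apply/funext => x; rewrite /= mxE.
have du : derivable (usubmx \o w) t 1 by apply/derivable_mxP => i j; rewrite uE.
have dd : derivable (dsubmx \o w) t 1 by apply/derivable_mxP => i j; rewrite dE.
split; split=> //; rewrite !derive_mx//; apply/matrixP => i j; rewrite !mxE.
- by rewrite uE.
- by rewrite dE.
Qed.

(** * The implicit Jacobian of the fixed point *)

Section ContractionImplicit.
Variables (R : realType) (p N : nat) (Theta : set 'cV[R]_p).
Variables (T : 'cV[R]_(p + N) -> 'cV[R]_N) (q : R) (zs : 'cV[R]_p -> 'cV[R]_N).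
Hypothesis oTheta : open Theta.
Hypothesis q01 : 0 <= q < 1.
Hypothesis Tq : forall theta z z', Theta theta ->
  sqn (T (col_mx theta z) - T (col_mx theta z')) <= q * sqn (z - z').
Hypothesis zsE : forall theta, Theta theta -> T (col_mx theta (zs theta)) = zs theta.

Let D := [set w : 'cV[R]_(p + N) | Theta (usubmx w)].
Hypothesis TL : locally_lipschitz D T.

Let D_col theta z : Theta theta -> D (col_mx theta z).
Proof. by rewrite /D /= col_mxKu. Qed.

Lemma jac_rsubmx_contraction (s : 'cV[R]_(p + N)) (x : 'cV[R]_N) :
  D s -> differentiable T s -> sqn (rsubmx (jac T s) *m x) <= q * sqn x.
Proof.
move=> Ds dT.
have -> : rsubmx (jac T s) *m x = jac T s *m col_mx 0 x.
  by rewrite -[X in X *m col_mx _ _]hsubmxK mul_row_col mulmx0 add0r.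
apply: (cvg_sqn_le (jac_mulmx_cvg (v := col_mx 0 x) dT)); exists 0%N => j _.
have j0 : j.+1%:R != 0 :> R by rewrite pnatr_eq0.
rewrite sqnZ -[s]vsubmxK scale_col_mx scaler0 add_col_mx addr0.
apply: (@le_trans _ _ (j.+1%:R ^+ 2 * (q * sqn (j.+1%:R^-1 *: x)))).
  rewrite ler_wpM2l ?sqr_ge0//; apply: le_trans (Tq _ _ Ds) _.
  by rewrite addrAC subrr add0r.
by rewrite sqnZ [leLHS](_ : _ = q * sqn x)//; field; rewrite addrC natr1.
Qed.

Lemma clarke_rsubmx_contraction (w : 'cV[R]_(p + N)) M (x : 'cV[R]_N) :
  D w -> clarke_jac T w M -> sqn (rsubmx M *m x) <= q * sqn x.
Proof.
move=> Dw [k [a [Ms [a0 [a1 [hMs ->]]]]]].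
rewrite linear_sum mulmx_suml.
under eq_bigr do rewrite linearZ/= -scalemxAl.
apply: sqn_convex => // i; have [s [sd [sw sM]]] := hMs i.
apply: (cvg_sqn_le (mulmx_cvg (v := x) (cvg_rsubmx sM))).
have [r [r0 rD]] := open_ballP (open_usubmx (N := N) oTheta) Dw.
have /cvg_seqP/(_ r r0)[K hK] := sw; exists K => j /hK/rD Dj.
exact: jac_rsubmx_contraction.
Qed.

Lemma clarke_rsubmx_unit theta z U V : Theta theta ->
  clarke_jac T (col_mx theta z) (row_mx U V) -> (1%:M - V) \in unitmx.
Proof.
(* The kernel [kermx] consists of row vectors, so transposing turns a singular [1 - V] into a fixed
   column vector of [V], which the contraction bound forces to be 0. *)
move=> Th cT; rewrite -unitmx_tr -row_free_unit -kermx_eq0.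
apply/negPn/negP => /rowV0Pn[v /sub_kermxP vA]; apply/negP/negPn/eqP.
have Vv : V *m v^T = v^T.
  have : (v *m (1%:M - V)^T)^T = 0 by rewrite vA trmx0.
  by rewrite trmx_mul trmxK mulmxBl mul1mx => /subr0_eq.
have := clarke_rsubmx_contraction v^T (D_col z Th) cT.
rewrite row_mxKr Vv => h; apply: (can_inj (@trmxK _ _ _)); rewrite trmx0.
have := sqn_ge0 v^T; have /andP[_ q1] := q01 => s0; apply: sqn_eq0.
have : (1 - q) * sqn v^T <= 0 by lra.
by rewrite pmulr_rle0// subr_gt0.
Qed.

(** The constant of [contraction_norm_le]; it serves for the Lipschitz bound of [zs] and for the
    size of the implicit Jacobians. *)
Let C := 2 * N.+1%:R / (1 - q).

Let C0 : 0 <= C.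
Proof. by have /andP[_ q1] := q01; rewrite divr_ge0// subr_ge0 ltW. Qed.

Let C_le (e d : 'cV[R]_N) : sqn (e - d) <= q * sqn e -> `|e| <= C * `|d|.
Proof.
move=> /(contraction_norm_le q01) h; have /andP[_ q1] := q01.
by rewrite /C mulrAC ler_pdivlMr ?subr_gt0// mulrC.
Qed.

(** Here [C_le] takes for [e] the difference of the fixed points and for [d] the change of [T] in
    [theta] alone; [e - d] is then a difference of values of [T] at one [theta], which [Tq]
    bounds. *)
Let zs_dist theta theta' : Theta theta -> Theta theta' ->
  `|zs theta - zs theta'| <=
    C * `|T (col_mx theta (zs theta')) - T (col_mx theta' (zs theta'))|.
Proof.
move=> Th Th'; apply: C_le; rewrite (zsE Th').
rewrite opprB addrA subrK -{1}(zsE Th); exact: Tq.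
Qed.

Lemma implicit_locally_lipschitz : locally_lipschitz Theta zs.
Proof.
move=> theta0 Th0; have [rT [rT0 hT]] := open_ballP oTheta Th0.
have [r [r0 [L hL]]] := TL (D_col (zs theta0) Th0).
have K0 : 0 < C * `|L| + 1 by rewrite ltr_wpDl// mulr_ge0.
have inball th x : `|th - theta0| < r -> `|x - zs theta0| < r ->
    `|col_mx th x - col_mx theta0 (zs theta0)| < r.
  by move=> h1 h2; rewrite col_mxB mx_norm_col_mx gt_max h1.
have lipT th th' x : `|th - theta0| < r -> `|th' - theta0| < r ->
    `|x - zs theta0| < r -> `|T (col_mx th x) - T (col_mx th' x)| <= `|L| * `|th - th'|.
  move=> h1 h2 h3; apply: le_trans (hL _ _ (inball _ _ h1 h3) (inball _ _ h2 h3)) _.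
  rewrite col_mxB subrr mx_norm_col_mx normr0 (max_idPl (normr_ge0 _)).
  by rewrite ler_wpM2r// ler_norm.
(* The last radius keeps [zs v] in the ball where [T] is Lipschitz, which the comparison of [u] with
   [v] requires. *)
exists (Num.min rT (Num.min r (r / (C * `|L| + 1)))).
split; first by rewrite !lt_min rT0 r0 divr_gt0.
exists (C * `|L|) => u v; rewrite !lt_min => /and3P[/hT Tu ur _] /and3P[/hT Tv vr vrC].
have zr : `|zs v - zs theta0| < r.
  apply: le_lt_trans (zs_dist Tv Th0) _.
  apply: (@le_lt_trans _ _ (C * (`|L| * `|v - theta0|))).
    by rewrite ler_wpM2l// lipT// subrr normr0.
  move: vrC; rewrite ltr_pdivlMr//; apply: le_lt_trans.
  have := normr_ge0 (v - theta0); lra.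
apply: le_trans (zs_dist Tu Tv) _.
rewrite -(mulrA C); apply: ler_wpM2l; [exact: C0|exact: lipT].
Qed.

Let zs_cvg (u : nat -> 'cV[R]_p) theta : Theta theta -> u @ \oo --> theta ->
  (fun j => zs (u j)) @ \oo --> zs theta.
Proof.
move=> Th /cvg_seqP uT; have [r [r0 [L hL]]] := implicit_locally_lipschitz Th.
apply/cvg_seqP => e e0; have K0 : 0 < `|L| + 1 by rewrite ltr_wpDl.
have [|K hK] := uT (Num.min r (e / (`|L| + 1))).
  by rewrite lt_min r0 divr_gt0.
exists K => j /hK; rewrite lt_min => /andP[jr]; rewrite ltr_pdivlMr//.
apply: le_lt_trans; apply: le_trans (hL _ _ jr _) _; first by rewrite subrr normr0.
rewrite mulrC ler_wpM2l//; have := ler_norm L; lra.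
Qed.

Definition implicit_jacobian (theta : 'cV[R]_p) : set 'M[R]_(N, p) :=
  [set M | exists U V, clarke_jac T (col_mx theta (zs theta)) (row_mx U V) /\
     M = invmx (1%:M - V) *m U].

(** With [U] and [V] the blocks of [A], the matrix [W] satisfies [W = V W + U], so [C_le] applies to
    each of its columns. *)
Let jacobian_norm_le theta A :
  Theta theta -> clarke_jac T (col_mx theta (zs theta)) A ->
  `|invmx (1%:M - rsubmx A) *m lsubmx A| <= C * `|A|.
Proof.
move=> Th cA.
have unit : (1%:M - rsubmx A) \in unitmx.
  by apply: (clarke_rsubmx_unit (U := lsubmx A) Th); rewrite hsubmxK; exact: cA.
set W := invmx _ *m _.
have WE : W = rsubmx A *m W + lsubmx A.
  have : (1%:M - rsubmx A) *m W = lsubmx A by rewrite /W mulKVmx.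
  by rewrite mulmxBl mul1mx => <-; rewrite addrC subrK.
apply: mx_norm_le => [|i j]; first by rewrite mulr_ge0.
have -> : W i j = col j W i 0 by rewrite [RHS]mxE.
apply: le_trans (mx_norm_entry _ _ _) _.
apply: (@le_trans _ _ (C * `|col j (lsubmx A)|)).
  apply: C_le; rewrite -linearB/= {1}WE addrK colE -mulmxA -colE.
  exact: clarke_rsubmx_contraction (D_col (zs theta) Th) cA.
rewrite ler_wpM2l//; apply: le_trans (mx_norm_lsubmx A).
by apply: mx_norm_le => // a b; rewrite mxE mx_norm_entry.
Qed.

Lemma implicit_jacobian_locally_bounded : locally_bounded_map Theta implicit_jacobian.
Proof.
move=> theta0 Th0; have [r [r0 [L hL]]] := TL (D_col (zs theta0) Th0).
have [r' [r'0 [L' hL']]] := implicit_locally_lipschitz Th0.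
have K0 : 0 < `|L'| + 1 by rewrite ltr_wpDl.
exists (Num.min r' (Num.min r (r / (`|L'| + 1)))).
split; first by rewrite !lt_min r'0 r0 divr_gt0.
exists (C * `|L|) => theta M Th; rewrite !lt_min => /and3P[tr' tr trL] [U [V [cT ->]]].
have := jacobian_norm_le Th cT; rewrite row_mxKl row_mxKr => /le_trans; apply.
rewrite ler_wpM2l//; apply: clarke_jac_norm_le hL _ cT.
rewrite col_mxB mx_norm_col_mx gt_max tr/=.
apply: le_lt_trans (hL' _ _ tr' _) _; first by rewrite subrr normr0.
move: trL; rewrite ltr_pdivlMr//; apply: le_lt_trans.
rewrite mulrC ler_wpM2l//; have := ler_norm L'; lra.
Qed.

(** Continuity of matrix inversion is avoided: the equation [M = V M + U] passes to the limit along
    a subsequence, and is solved for [M] there because [1 - V] is invertible at the limiting Clarke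
    element. *)
Lemma implicit_jacobian_closed : closed_graph_map Theta implicit_jacobian.
Proof.
move=> ts Ms theta M H tst MsM Th.
have {}H j : exists A, [/\ Theta (ts j), clarke_jac T (col_mx (ts j) (zs (ts j))) A &
    Ms j = rsubmx A *m Ms j + lsubmx A].
  have [Tj [U [V [cT ME]]]] := H j; exists (row_mx U V); split=> //.
  have unit := clarke_rsubmx_unit Tj cT.
  rewrite row_mxKl row_mxKr.
  have : (1%:M - V) *m Ms j = U by rewrite ME mulKVmx.
  by rewrite mulmxBl mul1mx => <-; rewrite addrC subrK.
have [A hA] := choice H.
have wc := cvg_col_mx tst (zs_cvg Th tst).
have [r [r0 [L hL]]] := TL (D_col (zs theta) Th).
have /cvg_seqP/(_ r r0)[K hK] := wc.
have shift_incr : increasing_seq (addn K) by move=> a b; exact: leq_add2l.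
have [|f [B [fi fB]]] := @mx_bolzano_weierstrass R _ _ (A \o addn K) `|L|.
  move=> j /=; have [_ cA _] := hA (K + j)%N.
  by apply: clarke_jac_norm_le hL _ cA; apply: hK; exact: leq_addr.
have cB : clarke_jac T (col_mx theta (zs theta)) B.
  apply: (clarke_jac_closed TL _ (cvg_subseq fi (cvg_subseq shift_incr wc)) fB).
    by move=> j /=; have [Tj cA _] := hA (K + f j)%N; split=> //; exact: D_col.
  exact: D_col.
exists (lsubmx B), (rsubmx B); rewrite hsubmxK; split=> //.
have unit : (1%:M - rsubmx B) \in unitmx.
  by apply: (clarke_rsubmx_unit (U := lsubmx B) Th); rewrite hsubmxK; exact: cB.
suff ME : (1%:M - rsubmx B) *m M = lsubmx B by rewrite -ME mulKmx.
rewrite mulmxBl mul1mx; apply/eqP; rewrite subr_eq addrC; apply/eqP.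
have MsM' := cvg_subseq fi (cvg_subseq shift_incr MsM).
apply/matrixP => i j; rewrite !mxE.
have /mx_cvg_seqP/(_ i j) h1 := MsM'.
apply: (cvg_unique (@norm_hausdorff R R) h1).
have -> : (fun k => ((Ms \o addn K) \o f) k i j) = (fun k =>
    (\sum_l (rsubmx (A (K + f k)%N) i l * Ms (K + f k)%N l j)) +
    lsubmx (A (K + f k)%N) i j).
  by apply/funext => k /=; have [_ _ {1}->] := hA (K + f k)%N; rewrite !mxE.
have /mx_cvg_seqP h2 := cvg_rsubmx fB; have /mx_cvg_seqP h3 := cvg_lsubmx fB.
move/mx_cvg_seqP in MsM'.
apply: cvgD; last by have := h3 i j; rewrite mxE.
apply: cvg_sum_seq => l.
by apply: cvgM; [exact: h2|exact: MsM'].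
Qed.

Hypothesis Tpd : path_differentiable D T.

(** The curve [w = (c, zs \o c)] is absolutely continuous, and [T \o w = zs \o c] on [[0, 1]].
    Differentiating with a Clarke element [[U V]] yields a linear equation for the derivative of
    [zs \o c], solved by inverting [1 - V]. *)
Lemma implicit_jacobian_chain_rule (c : R -> 'cV[R]_p) :
  abs_cont_curve c -> (forall t, 0 <= t <= 1 -> Theta (c t)) ->
  {ae (@lebesgue_measure R), forall t : R, 0 <= t <= 1 ->
     derivable c t 1 /\ derivable (zs \o c) t 1 /\
     forall M, implicit_jacobian (c t) M -> 'D_1 (zs \o c) t = M *m 'D_1 c t}.
Proof.
move=> cac cT; have [_ [J Jcons]] := Tpd.
pose w t := col_mx (c t) (zs (c t)).
have wac : abs_cont_curve w.
  have [K [d [K0 d0 hK]]] := locally_lipschitz_along_curve implicit_locally_lipschitz cac cT.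
  apply: (@abs_cont_dominated _ _ _ c w (1 + K) d) => // s t s0 st t1 std.
  have := hK s t s0 st t1 std.
  rewrite col_mxB mx_norm_col_mx ge_max mulrDl mul1r => h.
  by rewrite lerDl mulr_ge0//=; apply: le_trans h _; rewrite lerDr.
have wD t : 0 <= t <= 1 -> D (w t) by move=> t01; apply: D_col; exact: cT.
have [_ [_ [_ Jc]]] := Jcons.
apply: ae_lebesgue_segment; have := Jc w wac wD.
apply: ae_lebesgue_impl => t H /andP[t0 t1].
have t01 : 0 <= t <= 1 by rewrite !ltW.
have {H} [dw [dTw JE]] := H t01.
have nearE : \forall x \near t, (T \o w) x = (zs \o c) x.
  have : \forall x \near t, x \in `]0, 1[ by apply: near_in_itvoo; rewrite in_itv/= t0 t1.
  apply: filterS => x; rewrite in_itv/= => /andP[x0 x1].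
  by rewrite /= zsE//; apply: cT; rewrite !ltW.
have [du dd] := is_derive_submx dw.
have uwE : usubmx \o w = c by apply/funext => x; rewrite /= col_mxKu.
have dwE : dsubmx \o w = zs \o c by apply/funext => x; rewrite /= col_mxKd.
rewrite uwE in du; rewrite dwE in dd.
split; first exact: ex_derive.
split; first exact: ex_derive.
move=> M [U [V [cM ->]]].
have unit := clarke_rsubmx_unit (cT t t01) cM.
have E : 'D_1 (T \o w) t = row_mx U V *m 'D_1 w t.
  apply/esym; apply: (clarke_jac_mulmx (open_usubmx oTheta) TL Jcons (wD t t01) _ cM).
  by move=> M' /JE.
have d1 : 'D_1 c t = usubmx ('D_1 w t) by exact: derive_val.
have d2 : 'D_1 (zs \o c) t = dsubmx ('D_1 w t) by exact: derive_val.
have DE : 'D_1 (zs \o c) t = U *m 'D_1 c t + V *m 'D_1 (zs \o c) t.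
  rewrite -{1}(near_eq_derive _ nearE) E d1 d2.
  by rewrite -[X in _ *m X = _]vsubmxK mul_row_col.
have : (1%:M - V) *m 'D_1 (zs \o c) t = U *m 'D_1 c t.
  by rewrite mulmxBl mul1mx {1}DE addrK.
by rewrite -mulmxA => <-; rewrite mulKmx.
Qed.

End ContractionImplicit.

(** * Saddle points as fixed points of the resolvent *)

Unset Implicit Arguments.
Theorem theorem7 (R : realType) (p n m : nat)
  (Theta : set 'cV[R]_p) (X : set 'cV[R]_n) (Y : set 'cV[R]_m) (alpha : R)
  (Phi : 'cV[R]_p -> 'cV[R]_n -> 'cV[R]_m -> R) (gamma : R)
  (T : 'cV[R]_(p + (n + m)) -> 'cV[R]_(n + m)) :
  Theta !=set0 -> open Theta -> connected Theta ->
  X !=set0 -> closed X -> convex_set X ->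
  Y !=set0 -> convex_set Y -> compact Y ->
  0 < alpha ->
  (forall theta, Theta theta ->
     continuous (fun xy : 'cV[R]_n * 'cV[R]_m => Phi theta xy.1 xy.2) /\
     (forall y, strongly_convex alpha (fun x => Phi theta x y)) /\
     (forall x, strongly_convex alpha (fun y => - Phi theta x y))) ->
  (forall x y, exists L : R, forall theta1 theta2, Theta theta1 -> Theta theta2 ->
     `|Phi theta1 x y - Phi theta2 x y| <= L * `|theta1 - theta2|) ->
  0 < gamma < alpha^-1 ->
  (forall theta z, Theta theta ->
     is_resolvent (saddle_op (Phi theta) X Y) gamma z (T (col_mx theta z))) ->
  path_differentiable [set w | Theta (usubmx w)] T ->
  exists zs : 'cV[R]_p -> 'cV[R]_(n + m),
    (forall theta, Theta theta ->
       is_saddle (Phi theta) X Y (zs theta) /\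
       (forall z, is_saddle (Phi theta) X Y z -> z = zs theta) /\
       saddle_op (Phi theta) X Y (zs theta) 0 /\
       (forall z, saddle_op (Phi theta) X Y z 0 -> z = zs theta)) /\
    (forall theta U V, Theta theta ->
       clarke_jac T (col_mx theta (zs theta)) (row_mx U V) ->
       (1%:M - V) \in unitmx) /\
    path_differentiable Theta zs /\
    conservative_jacobian Theta zs
      (fun theta => [set M | exists U V,
         clarke_jac T (col_mx theta (zs theta)) (row_mx U V) /\
         M = invmx (1%:M - V) *m U]).
Proof.
move=> _ oTheta _ _ _ cX _ cY _ a0 HPhi _ /andP[g0 _] Tres Tpd.
have k1 : 1 < 1 + gamma * alpha by rewrite ltrDl mulr_gt0.
pose q := (1 + gamma * alpha) ^- 2.
have q01 : 0 <= q < 1.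
  rewrite /q invr_ge0 exprn_ge0/= ?ltW//; last exact: lt_trans k1.
  by rewrite invf_lt1 ?exprn_gt0 ?exprn_egt1//; exact: lt_trans k1.
have Tq theta z z' : Theta theta ->
    sqn (T (col_mx theta z) - T (col_mx theta z')) <= q * sqn (z - z').
  move=> Th; have [_ [Px Py]] := HPhi theta Th.
  exact: resolvent_contraction Px Py _ _ _ _ _ a0 g0 (Tres theta z Th) (Tres theta z' Th).
have fixpoint (theta : 'cV[R]_p) : exists z, Theta theta -> T (col_mx theta z) = z.
  (* Outside [Theta] nothing is known of [T], and the value 0 is a default. *)
  have [Th|nTh] := pselect (Theta theta); last by exists 0.
  have [z zE] := sqn_contraction_fixpoint q01 (fun z z' => Tq theta z z' Th).
  by exists z.
have [zs zsE] := choice fixpoint.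
have [TL _] := Tpd.
have zsL := implicit_locally_lipschitz oTheta q01 Tq zsE TL.
have Jcons : conservative_jacobian Theta zs (implicit_jacobian T zs).
  split; last split; last split.
  - move=> theta Th; have [_ [J Jcons]] := Tpd.
    have Dw : Theta (usubmx (col_mx theta (zs theta))) by rewrite col_mxKu.
    have [M cM] := clarke_lim_nonempty (open_usubmx (N := n + m) oTheta) TL Jcons Dw.
    exists (invmx (1%:M - rsubmx M) *m lsubmx M), (lsubmx M), (rsubmx M).
    by rewrite hsubmxK; split=> //; exact: clarke_jac_lim.
  - exact: (implicit_jacobian_locally_bounded oTheta q01 Tq zsE TL).
  - exact: (implicit_jacobian_closed oTheta q01 Tq zsE TL).
  - exact: (implicit_jacobian_chain_rule oTheta q01 Tq zsE TL Tpd).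
exists zs; split; last split; last split.
- move=> theta Th; have [_ [Px Py]] := HPhi theta Th.
  (* At a fixed point, [gamma] times the chosen element of the operator is 0, so that element is 0
     because [gamma] is positive. *)
  have zero : saddle_op (Phi theta) X Y (zs theta) 0.
    have [a [Aa]] := Tres theta (zs theta) Th.
    rewrite zsE// subrr => /esym/eqP; rewrite scaler_eq0 gt_eqF//= => /eqP a_eq0.
    by rewrite -a_eq0 -{1}(zsE theta Th).
  have saddle := saddle_op_zero_saddle zero.
  split=> //; split; first by move=> z zS; exact: (saddle_unique Px Py a0 cX cY).
  split=> // z /saddle_op_zero_saddle zS; exact: (saddle_unique Px Py a0 cX cY).
- by move=> theta U V Th; exact: (clarke_rsubmx_unit oTheta q01 Tq).
- by split=> //; exists (implicit_jacobian T zs).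
- exact: Jcons.
Qed.
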